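(* Let $P_v(n)$ be defined by $\sum_{n=0}^{\infty}P_v(n)q^n=v(q)$, where $v(q)=\sum_{n=0}^{\infty}\dfrac{q^{(n+1)^2}(-q;q^2)_n}{(q;q^2)_{n+1}}$. Then for every integer $n\ge 0$, $$P_v(6n+5)+\sum_{m=1}^{\infty}(-1)^m\Big(P_v(6n-9m^2-3m+5)+P_v(6n-9m^2+3m+5)\Big)$$ $$=3\sum_{t=0}^{\infty}\ \sum_{c=0}^{\left\lfloor \frac{n-3t^2-3t}{2}\right\rfloor}(-1)^t(2t+1)\,p_{2d}\left(n-3t^2-3t-2c\right)\bar{p}(c).$$
   Context: Notation: $(b;q)_n=\prod_{k=0}^{n-1}(1-bq^k)$ and $\ell_k=\prod_{m\ge1}(1-q^{km})$. $\bar p(n)$ is the number of overpartitions of $n$, with $\sum_{n\ge0}\bar p(n)q^n=\ell_2/\ell_1^2$. $p_{2d}(n)$ is the number of partitions of $n$ into distinct parts with $2$ copies (colours), with $\sum_{n\ge0}p_{2d}(n)q^n=(\ell_2/\ell_1)^2$. Conventions: $P_v(m)=0$ for $m<0$, and the inner sum over $c$ is empty (equal to $0$) when its upper limit is negative. *)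

(* Defs.v *)
From HB Require Import structures.
From mathcomp Require Import all_boot all_order all_algebra.
From mathcomp Require Import boolp classical_sets functions cardinality fsbigop.

Set Implicit Arguments.
Unset Strict Implicit.
Unset Printing Implicit Defensive.
Import Order.TTheory GRing.Theory Num.Theory.
Local Open Scope classical_set_scope.
Local Open Scope ring_scope.

Section FormalPowerSeries.
Variable R : comUnitRingType.

(* f : fps R stands for \sum_n f n q^n in R[[q]].  The alias keeps the Cauchy
   product apart from the pointwise product on functions. *)
Definition fps : Type := nat -> R.

HB.instance Definition _ := Choice.copy fps (nat -> R).

Implicit Types f g h : fps.

Definition fps0 : fps := fun _ => 0.
Definition fpsC (c : R) : fps := fun n => if n == 0%N then c else 0.
Definition fps_opp f : fps := fun n => - f n.
Definition fps_add f g : fps := fun n => f n + g n.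
Definition fps_mul f g : fps := fun n => \sum_(i < n.+1) f i * g (n - i)%N.

Fact fps_addA : associative fps_add.
Proof. by move=> f g h; apply/funext => n; exact: addrA. Qed.
Fact fps_addC : commutative fps_add.
Proof. by move=> f g; apply/funext => n; exact: addrC. Qed.
Fact fps_add0 : left_id fps0 fps_add.
Proof. by move=> f; apply/funext => n; exact: add0r. Qed.
Fact fps_addN : left_inverse fps0 fps_opp fps_add.
Proof. by move=> f; apply/funext => n; exact: addNr. Qed.

HB.instance Definition _ :=
  GRing.isZmodule.Build fps fps_addA fps_addC fps_add0 fps_addN.

(* Ring identities are transferred from the polynomials that truncate f, g, h
   above degree n. *)
Definition fps_trunc n f : {poly R} := \poly_(i < n.+1) f i.

Fact fps_mul_trunc n f g m : (m <= n)%N ->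
  fps_mul f g m = (fps_trunc n f * fps_trunc n g)`_m.
Proof.
move=> le_mn; rewrite coefM; apply: eq_bigr => i _; rewrite !coef_poly.
have le_im : (i <= m)%N by rewrite -ltnS.
by rewrite !ltnS (leq_trans le_im) // (leq_trans (leq_subr _ _)).
Qed.

Fact fps_mulC : commutative fps_mul.
Proof.
by move=> f g; apply/funext => n; rewrite !(fps_mul_trunc _ _ (leqnn n)) mulrC.
Qed.

Fact fps_mulA : associative fps_mul.
Proof.
move=> f g h; apply/funext => n.
transitivity ((fps_trunc n f * (fps_trunc n g * fps_trunc n h))`_n).
  rewrite coefM; apply: eq_bigr => i _; rewrite coef_poly ltn_ord.
  by rewrite -fps_mul_trunc // leq_subr.
rewrite mulrA coefM; apply: eq_bigr => i _.
by rewrite coef_poly ltnS leq_subr -fps_mul_trunc // -ltnS.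
Qed.

Fact fps_mul1 : left_id (fpsC 1) fps_mul.
Proof.
move=> f; apply/funext => n; rewrite /fps_mul big_ord_recl /= subn0 mul1r.
by rewrite big1 ?addr0 // => i _; rewrite /fpsC /= mul0r.
Qed.

Fact fps_mulDl : left_distributive fps_mul fps_add.
Proof.
move=> f g h; apply/funext => n; rewrite /fps_mul /fps_add -big_split.
by apply: eq_bigr => i _; rewrite mulrDl.
Qed.

Fact fps_oner_neq0 : fpsC 1 != fps0.
Proof. by apply/eqP => /(congr1 (fun f : fps => f 0%N))/eqP; rewrite oner_eq0. Qed.

HB.instance Definition _ := GRing.Zmodule_isComNzRing.Build fps
  fps_mulA fps_mulC fps_mul1 fps_mulDl fps_oner_neq0.

Lemma coef_fpsD f g n : (f + g) n = f n + g n. Proof. by []. Qed.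
Lemma coef_fpsN f n : (- f) n = - f n. Proof. by []. Qed.
Lemma coef_fpsB f g n : (f - g) n = f n - g n. Proof. by []. Qed.
Lemma coef_fpsM f g n : (f * g) n = \sum_(i < n.+1) f i * g (n - i)%N.
Proof. by []. Qed.
Lemma coef_fps1 n : (1 : fps) n = (n == 0%N)%:R.
Proof. by rewrite /GRing.one /= /fpsC; case: n. Qed.
Lemma coef_fps_sum (I : Type) (r : seq I) (P : pred I) (F : I -> fps) n :
  (\sum_(i <- r | P i) F i) n = \sum_(i <- r | P i) F i n.
Proof. by apply: (big_morph (fun f : fps => f n)). Qed.
Lemma coef_fpsCM c f n : (fpsC c * f) n = c * f n.
Proof.
rewrite coef_fpsM big_ord_recl /= subn0.
by rewrite big1 ?addr0 // => i _; rewrite /fpsC /= mul0r.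
Qed.
Lemma fpsCM c d : fpsC (c * d) = fpsC c * fpsC d.
Proof.
by apply/funext => n; rewrite coef_fpsCM /fpsC; case: eqP; rewrite ?mulr0.
Qed.

Lemma coef_fpsX_small f k n : f 0%N = 0 -> (n < k)%N -> (f ^+ k) n = 0.
Proof.
move=> f0; elim: k n => // k IHk n lt_nk; rewrite exprS coef_fpsM.
rewrite big_ord_recl f0 mul0r add0r big1 // => i _.
by rewrite IHk ?mulr0 // lift0; case: n lt_nk i => [_ []|n lt_nk i] //; rewrite subSS (leq_ltn_trans (leq_subr _ _)).
Qed.

(* f is invertible iff f 0 is; writing f = c (1 - u) with c := f 0, one has
   f^-1 = c^-1 \sum_k u^k, where u^k has no term of degree < k. *)
Definition fps_unit : {pred fps} := fun f => f 0%N \is a GRing.unit.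
Definition fps_inv f : fps :=
  if f 0%N \is a GRing.unit then
    let u : fps := 1 - fpsC (f 0%N)^-1 * f in
    fun n => (f 0%N)^-1 * \sum_(k < n.+1) (u ^+ k) n
  else f.

Fact fps_mulV : {in fps_unit, left_inverse 1 fps_inv *%R}.
Proof.
move=> f Uf; rewrite unfold_in /= in Uf; rewrite mulrC.
rewrite /fps_inv Uf; set u : fps := 1 - _ * f.
have u0 : u 0%N = 0 by rewrite /u coef_fpsB coef_fps1 coef_fpsCM mulVr // subrr.
have fE : f = fpsC (f 0%N) * (1 - u).
  by rewrite /u opprB addrCA subrr addr0 mulrA -fpsCM mulrV // -/(1 : fps) mul1r.
apply/funext => n.
transitivity ((f * (fpsC (f 0%N)^-1 * \sum_(k < n.+1) u ^+ k)) n).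
  rewrite !coef_fpsM; apply: eq_bigr => i _; congr (_ * _).
  rewrite coef_fpsCM coef_fps_sum; congr (_ * _).
  have le_in : ((n - i).+1 <= n.+1)%N by rewrite ltnS leq_subr.
  rewrite (big_ord_widen _ (fun k => (u ^+ k) (n - i)%N) le_in) big_mkcond /=.
  apply: eq_bigr => k _; case: ltnP => // lt_k.
  by rewrite coef_fpsX_small.
rewrite {1}fE mulrACA -fpsCM mulrV // -/(1 : fps) mul1r.
have -> : (1 - u) * \sum_(k < n.+1) u ^+ k = 1 - u ^+ n.+1.
  by rewrite -opprB mulNr -subrX1 opprB.
by rewrite coef_fpsB coef_fpsX_small ?subr0.
Qed.

Fact fps_unitPl f g : g * f = 1 -> fps_unit f.
Proof.
move=> /(congr1 (fun f : fps => f 0%N)); rewrite coef_fpsM big_ord1 subn0.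
rewrite coef_fps1 => gf1; rewrite /fps_unit; apply/unitrPr.
by exists (g 0%N); rewrite mulrC.
Qed.

Fact fps_inv_out : {in [predC fps_unit], fps_inv =1 id}.
Proof. by move=> f; rewrite inE unfold_in /fps_inv => /negPf ->. Qed.

HB.instance Definition _ := GRing.ComNzRing_hasMulInverse.Build fps
  fps_mulV fps_unitPl fps_inv_out.

Definition fpsX : fps := fun n => (n == 1%N)%:R.

(* The infinite sum \sum_(k >= 0) F k of a family in which each power of q
   occurs in finitely many F k; \sum_(_ \in _) is the sum of a finitely
   supported family. *)
Definition fps_series (F : nat -> fps) : fps :=
  fun n => \sum_(k \in [set: nat]) F k n.

End FormalPowerSeries.

(* (b; q)_n *)
Definition qpoch (A : comNzRingType) (b q : A) (n : nat) : A :=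
  \prod_(k < n) (1 - b * q ^+ k).

Definition v_term (n : nat) : fps int :=
  let q : fps int := fpsX int in
  q ^+ ((n.+1) ^ 2) * qpoch (- q) (q ^+ 2) n / qpoch q (q ^+ 2) n.+1.

(* The quotient in v_term is a genuine one, and the series of the v_term is
   locally finite. *)
Lemma qpochX_unit (k : nat) :
  qpoch (fpsX int) (fpsX int ^+ 2) k \is a GRing.unit.
Proof.
have coef0M (f g : fps int) : (f * g) 0%N = f 0%N * g 0%N.
  by rewrite coef_fpsM big_ord1.
rewrite unfold_in /= /fps_unit /qpoch.
suff -> : (\prod_(i < k) (1 - fpsX int * fpsX int ^+ 2 ^+ i)) 0%N = 1 by [].
elim/big_ind: _ => //= [x y|i _]; first by rewrite coef0M => -> ->.
by rewrite coef_fpsB coef0M coef_fps1 mul0r.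
Qed.

Lemma v_term_small (k n : nat) : (n < k.+1 ^ 2)%N -> v_term k n = 0.
Proof.
move=> lt_n; rewrite /v_term -mulrA coef_fpsM big1 // => i _.
rewrite coef_fpsX_small ?mul0r //.
by rewrite (leq_ltn_trans _ lt_n) // -ltnS.
Qed.

Definition v_series : fps int := fps_series v_term.

Definition P_v (m : int) : int := if m is Posz k then v_series k else 0.

(* A partition of n is given by the multiplicity x.1 i <= n of each part i + 1
   with i < n; x.2 is the set of the part sizes whose first occurrence is
   overlined. *)
Definition overpartitions (n : nat) :
    {set {ffun 'I_n -> 'I_n.+1} * {set 'I_n}} :=
  [set x : {ffun 'I_n -> 'I_n.+1} * {set 'I_n} |
    (\sum_(i < n) x.1 i * i.+1 == n)%N && [forall i in x.2, 0 < x.1 i]%N].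

Definition pbar (n : nat) : nat := #|overpartitions n|.

(* x.1 and x.2 are the sets of the parts of the first and of the second colour;
   the index i stands for the part i + 1. *)
Definition distinct2_partitions (n : nat) : {set {set 'I_n} * {set 'I_n}} :=
  [set x : {set 'I_n} * {set 'I_n} |
    (\sum_(i in x.1) i.+1 + \sum_(i in x.2) i.+1 == n)%N].

Definition p2d (n : nat) : nat := #|distinct2_partitions n|.

(* Main.v *)
Require Import Defs.
From HB Require Import structures.
From mathcomp Require Import all_boot all_order all_algebra.
From mathcomp Require Import zify ring.
From mathcomp Require Import boolp classical_sets functions cardinality fsbigop.

(** Write [ell k] for the product of the 1 - q^(k m) over m >= 1.  As
    6n - 9m^2 - 3m + 5 = 6(n - (3m^2 + m)/2) + 5, the pentagonal number theorem
    makes the left-hand side the coefficient of q^n in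
    [ell 1] * sum_n P_v(6n+5) q^n.  Jacobi's series for [ell 6 ^+ 3] and the
    products that count overpartitions and pairs of distinct partitions make the
    right-hand side the coefficient of q^n in 3 ell6^3 ell4 / ell1^2.  What has
    to be shown is therefore

        sum_n P_v(6n+5) q^n = 3 ell4 ell6^3 / ell1^3.

    The series v is a mock theta function, but its odd part is a product
    ([v_odd_eta]):

        O := sum_n P_v(2n+1) q^n = ell4^3 / (ell1 ell2).

    Indeed, multiply the n-th term of v by (q^2;q^4)_oo and expand it by the
    q-binomial theorem; this gives the sum over n, i, j >= 0 of

        (-1)^i q^((n+1+i)^2 + (j-n)^2) / ((q^2;q^2)_i (q^2;q^2)_j).

    The odd exponents are those with i + j even, and for these the summand is
    invariant under (n, i, j) -> (-n-1, j, i) ([vhalf_sym]).  So twice the odd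
    part is the same sum with n ranging over all integers, where the
    substitution n = k + (j - i)/2 separates k from i and j ([vhalf_diag]).  The
    sum over k is a theta series; the sum over i + j = 2M is evaluated by
    Gauss's alternating sum of q-binomial coefficients, and what is left is
    Euler's series for (-q^2;q^2)_oo.

    It remains to extract the exponents 2 mod 3 from O ([eta_dissect3]).
    Splitting a product of two theta series, as a sum over pairs of integers,
    by the parity of the sum of the two indices ([theta_schroter]) yields

        ell3^3 O = psi(q^2)^3 phi(-q^6) + q ell12^3 psi(q^2),

    where psi = ell2^2/ell1 and phi(-q) = ell1^2/ell2.  Now
    psi(q) = a(q^3) + q psi(q^9), so psi(q^2) has exponents 0 and 2 mod 3 only.
    The second summand has no exponent 2 mod 3, and in the cube only
    3 a(q^6)^2 q^2 psi(q^18) does: this is where the factor 3 comes from.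

    All product identities are limits, in the topology where q is small, of one
    polynomial identity, the finite Jacobi triple product [finite_jtp]. *)

Set Implicit Arguments.
Unset Strict Implicit.
Unset Printing Implicit Defensive.
Import Order.TTheory GRing.Theory Num.Theory.
Local Open Scope classical_set_scope.
Local Open Scope ring_scope.

(** * Convergence and summable families of power series *)
Section Order.
Variable R : comUnitRingType.
Local Notation A := (fps R).
Local Notation q := (fpsX R).
Implicit Types f g h : A.

Lemma fpsP f g : (forall n, f n = g n) -> f = g.
Proof. by move=> e; apply/funext. Qed.

(** q^d divides f.  Thus [vanish d (f - g)] is congruence modulo q^d, the relation
    in which all limits below are expressed. *)
Definition vanish (d : nat) f : Prop := forall i, (i < d)%N -> f i = 0.

Lemma vanishD d f g : vanish d f -> vanish d g -> vanish d (f + g).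
Proof. by move=> vf vg i lt_id; rewrite coef_fpsD vf // vg // addr0. Qed.

Lemma vanishN d f : vanish d f -> vanish d (- f).
Proof. by move=> vf i lt_id; rewrite coef_fpsN vf // oppr0. Qed.

Lemma vanishB d f g : vanish d f -> vanish d g -> vanish d (f - g).
Proof. by move=> vf vg; apply/vanishD/vanishN. Qed.

Lemma vanishM d e f g : vanish d f -> vanish e g -> vanish (d + e) (f * g).
Proof.
move=> vf vg i lt_i; rewrite coef_fpsM big1 // => j _.
have [lt_jd|le_dj] := ltnP j d; first by rewrite vf // mul0r.
by rewrite vg ?mulr0 //; have := ltn_ord j; lia.
Qed.

Lemma vanishW d e f : (e <= d)%N -> vanish d f -> vanish e f.
Proof. by move=> le_ed vf i lt_i; apply: vf; apply: leq_trans le_ed. Qed.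

Lemma vanishMr d f g : vanish d g -> vanish d (f * g).
Proof. by move=> vg; rewrite -[d]add0n; apply: vanishM. Qed.

Lemma vanishMl d f g : vanish d f -> vanish d (f * g).
Proof. by move=> vf; rewrite mulrC; apply: vanishMr. Qed.

Lemma vanishX d f n : vanish d f -> vanish (d * n) (f ^+ n).
Proof.
by move=> vf; elim: n => [|n IHn]; rewrite ?muln0 // exprS mulnS; apply: vanishM.
Qed.

Lemma vanish_q : vanish 1 q.
Proof. by move=> [|i]. Qed.

Lemma vanish_qX n : vanish n (q ^+ n).
Proof. by rewrite -{1}[n]mul1n; apply/vanishX/vanish_q. Qed.

Lemma coef_qXM n f i : (q ^+ n * f) i = if (i < n)%N then 0 else f (i - n)%N.
Proof.
elim: n i => [|n IHn] i; first by rewrite expr0 mul1r subn0.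
rewrite exprS -mulrA coef_fpsM; case: i => [|i].
  by rewrite big_ord1 mul0r.
rewrite 2!big_ord_recl big1 => [|j _]; last by rewrite mul0r.
rewrite -[q ord0]/(0 : R) -[q (lift _ _)]/(1 : R) mul0r add0r addr0 mul1r.
by rewrite lift0 !subSS subn0 IHn.
Qed.

Lemma coef0_fpsM f g : (f * g) 0%N = f 0%N * g 0%N.
Proof. by rewrite coef_fpsM big_ord1. Qed.

Lemma unit_fpsE f : (f \is a GRing.unit) = (f 0%N \is a GRing.unit).
Proof. by []. Qed.

Lemma eqm_mul d f f' g g' :
  vanish d (f - f') -> vanish d (g - g') -> vanish d (f * g - f' * g').
Proof.
move=> ef eg.
have -> : f * g - f' * g' = (f - f') * g + f' * (g - g') by ring.
by apply: vanishD; [apply: vanishMl | apply: vanishMr].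
Qed.

Lemma eqm_inv d f g : f \is a GRing.unit -> g \is a GRing.unit ->
  vanish d (f - g) -> vanish d (f^-1 - g^-1).
Proof.
move=> Uf Ug e.
have -> : f^-1 - g^-1 = f^-1 * g^-1 * (g - f).
  by rewrite mulrBr mulrVK // [f^-1 * _]mulrC mulrVK.
by apply: vanishMr; rewrite -opprB; apply: vanishN.
Qed.

Lemma eqm_trans d f g h : vanish d (f - g) -> vanish d (g - h) -> vanish d (f - h).
Proof. by move=> e e'; rewrite -(subrKA g); apply: vanishD. Qed.

Lemma eqm_sym d f g : vanish d (f - g) -> vanish d (g - f).
Proof. by move=> e; rewrite -opprB; apply: vanishN. Qed.

Definition conv (F : nat -> A) f : Prop :=
  forall d, exists N0, forall N, (N0 <= N)%N -> vanish d (F N - f).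

Lemma conv_cst f : conv (fun=> f) f.
Proof. by move=> d; exists 0%N => N _; rewrite subrr. Qed.

Lemma conv_unique F f g : conv F f -> conv F g -> f = g.
Proof.
move=> cf cg; apply/fpsP => n; apply/eqP; rewrite -subr_eq0 -coef_fpsB.
have [N1 h1] := cf n.+1; have [N2 h2] := cg n.+1.
have e1 := h1 (maxn N1 N2) (leq_maxl _ _).
have e2 := h2 (maxn N1 N2) (leq_maxr _ _).
by rewrite (eqm_trans (eqm_sym e1) e2).
Qed.

Lemma eq_conv F G f : (forall N, F N = G N) -> conv F f -> conv G f.
Proof. by move=> /funext ->. Qed.

Lemma convM F G f g : conv F f -> conv G g -> conv (fun N => F N * G N) (f * g).
Proof.
move=> cf cg d; have [N1 h1] := cf d; have [N2 h2] := cg d.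
exists (maxn N1 N2) => N le_N; apply: eqm_mul; [apply: h1 | apply: h2]; lia.
Qed.

Lemma convV F f : (forall N, F N \is a GRing.unit) -> f \is a GRing.unit ->
  conv F f -> conv (fun N => (F N)^-1) f^-1.
Proof.
move=> UF Uf cf d; have [N0 h] := cf d.
by exists N0 => N le_N; apply: eqm_inv => //; apply: h.
Qed.

Lemma conv_comp F f (u : nat -> nat) :
  (forall d, exists N0, forall N, N0 <= N -> d <= u N)%N ->
  conv F f -> conv (F \o u) f.
Proof.
move=> tu cf d; have [N0 h] := cf d; have [N1 h1] := tu N0.
by exists N1 => N /h1 le_N; apply: h.
Qed.

Lemma conv_eventually F f u : conv F f ->
  (exists N1, forall N, (N1 <= N)%N -> u N = F N) -> conv u f.
Proof.
move=> cf [N1 hu] d; have [N0 h] := cf d.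
exists (maxn N0 N1) => N le_N; rewrite hu; [apply: h|]; lia.
Qed.

Lemma unit_coef0 f : f 0%N = 1 -> f \is a GRing.unit.
Proof. by rewrite unit_fpsE => ->; apply: unitr1. Qed.

(** Only finitely many members are nonzero modulo q^d.  Lists serve as the finite
    sets, over any choice type, so that sums over pairs and over integers
    are treated alike. *)
Definition summable (T : choiceType) (F : T -> A) : Prop :=
  forall d, exists s : seq T, forall t, t \notin s -> vanish d (F t).

(** A function with finite sublevel sets; as a lower bound for the exponents of a
    family it makes the family summable. *)
Definition proper_map (T : choiceType) (o : T -> nat) : Prop :=
  forall d, exists s : seq T, forall t, t \notin s -> (d <= o t)%N.

Definition fsum (T : choiceType) (F : T -> A) : A :=
  fun d => \sum_(t \in [set: T]) F t d.

Section Fsum.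
Variable T : choiceType.
Implicit Types (F G : T -> A) (o : T -> nat).

Lemma summable_uniq F : summable F ->
  forall d, exists2 s : seq T, uniq s & forall t, t \notin s -> vanish d (F t).
Proof.
move=> sF d; have [s hs] := sF d; exists (undup s); first exact: undup_uniq.
by move=> t; rewrite mem_undup; apply: hs.
Qed.

Lemma proper_summable o F : proper_map o -> (forall t, vanish (o t) (F t)) -> summable F.
Proof.
by move=> po vF d; have [s hs] := po d; exists s => t /hs le_d; apply: vanishW (vF t).
Qed.

Lemma eq_fsum F G : (forall t, F t = G t) -> fsum F = fsum G.
Proof. by move=> /funext ->. Qed.

Lemma coef_fsum F d (s : seq T) : uniq s ->
  (forall t, t \notin s -> F t d = 0) -> fsum F d = \sum_(t <- s) F t d.
Proof.
move=> us hs; rewrite /fsum (fsbigE s) // => [|t _]; last exact: hs.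
by apply: eq_bigl => t; rewrite in_setT.
Qed.

Lemma eqm_fsum F d (s : seq T) : uniq s ->
  (forall t, t \notin s -> vanish d (F t)) ->
  vanish d (fsum F - \sum_(t <- s) F t).
Proof.
move=> us hs i lt_i; rewrite coef_fpsB (coef_fsum us) => [|t /hs]; last exact.
by rewrite coef_fps_sum subrr.
Qed.

Lemma fsum_fin F (s : seq T) : uniq s ->
  (forall t, t \notin s -> F t = 0) -> fsum F = \sum_(t <- s) F t.
Proof.
move=> us hs; apply/fpsP => d; rewrite (coef_fsum us) ?coef_fps_sum //.
by move=> t /hs ->.
Qed.

Lemma eqm_eq f g : (forall d, vanish d (f - g)) -> f = g.
Proof.
by move=> h; apply/fpsP => n; apply/eqP; rewrite -subr_eq0 -coef_fpsB (h n.+1).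
Qed.

Lemma fsumMl c F : summable F -> fsum (fun t => c * F t) = c * fsum F.
Proof.
move=> sF; apply: eqm_eq => d; have [s us hs] := summable_uniq sF d.
apply: (@eqm_trans _ _ (\sum_(t <- s) c * F t)).
  by apply: eqm_fsum => // t /hs; apply: vanishMr.
by rewrite -mulr_sumr; apply: eqm_mul; [rewrite subrr | apply/eqm_sym/eqm_fsum].
Qed.

End Fsum.

Lemma fsum_bij (T U : choiceType) (h : T -> U) (F : U -> A) : bijective h ->
  fsum F = fsum (F \o h).
Proof. by move=> bh; apply/fpsP => d; rewrite /fsum (reindex_fsbigT h). Qed.

(** Used to change the index type of a sum when the new indices do not exhaust
    the old ones. *)
Lemma fsum_inj (T U : choiceType) (h : T -> U) (F : U -> A) : injective h ->
  (forall u, ~ (exists t, h t = u) -> F u = 0) -> fsum F = fsum (F \o h).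
Proof.
move=> ih hF; apply/fpsP => d; rewrite /fsum.
rewrite -(fsbig_widen (h @` setT)) //; last first.
  move=> u [_ /= hu]; rewrite hF // => -[t tu]; apply: hu; exists t => //.
by rewrite fsbig_image // => t u _ _; apply: ih.
Qed.

(** Modulo q^d both sides are sums over a finite rectangle that contains the
    relevant pairs. *)
Lemma fsum_pair (T U : choiceType) (F : T * U -> A) : summable F ->
  fsum F = fsum (fun t => fsum (fun u => F (t, u))).
Proof.
move=> sF; apply/fpsP => d; have [s hs] := sF d.+1.
pose s1 := undup (map fst s); pose s2 := undup (map snd s).
have h1 t u : t \notin s1 -> F (t, u) d = 0.
  move=> ht; apply: hs => //; apply: contra ht => htu.
  by rewrite mem_undup; apply/mapP; exists (t, u).
have h2 t u : u \notin s2 -> F (t, u) d = 0.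
  move=> ht; apply: hs => //; apply: contra ht => htu.
  by rewrite mem_undup; apply/mapP; exists (t, u).
have us1 : uniq s1 := undup_uniq _; have us2 : uniq s2 := undup_uniq _.
rewrite (@coef_fsum _ _ _ [seq (t, u) | t <- s1, u <- s2]); first last.
- move=> [t u] h; have [ht|/(h1 t u) //] := boolP (t \in s1).
  have [hu|/(h2 t u) //] := boolP (u \in s2).
  by case/negP: h; apply/allpairsP; exists (t, u).
- by apply: allpairs_uniq => // -[? ?] [? ?] _ _ [-> ->].
rewrite (@coef_fsum _ _ _ s1) //; last first.
  by move=> t ht; rewrite (@coef_fsum _ _ _ [::]) ?big_nil // => u _; apply: h1.
rewrite big_allpairs; apply: eq_bigr => t _.
by rewrite (@coef_fsum _ _ _ s2) // => u /(h2 t).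
Qed.

Lemma summable_comp (T U : choiceType) (h : T -> U) (g : U -> T) (F : U -> A) :
  cancel h g -> summable F -> summable (F \o h).
Proof.
move=> hK sF d; have [s hs] := sF d; exists (map g s) => t ht.
by apply: hs; apply: contra ht => ht; apply/mapP; exists (h t).
Qed.

Lemma summable_prod (T U : choiceType) (F : T -> A) (G : U -> A) :
  summable F -> summable G -> summable (fun tu : T * U => F tu.1 * G tu.2).
Proof.
move=> sF sG d; have [s hs] := sF d; have [s' hs'] := sG d.
exists [seq (t, u) | t <- s, u <- s'] => -[t u] h /=.
have [ht|/hs] := boolP (t \in s); last exact: vanishMl.
have [hu|/hs'] := boolP (u \in s'); last exact: vanishMr.
by case/negP: h; apply/allpairsP; exists (t, u).
Qed.

Lemma fsumM (T U : choiceType) (F : T -> A) (G : U -> A) :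
  summable F -> summable G ->
  fsum F * fsum G = fsum (fun tu : T * U => F tu.1 * G tu.2).
Proof.
move=> sF sG; rewrite fsum_pair /=; last exact: summable_prod.
rewrite mulrC -fsumMl //; apply: eq_fsum => t.
by rewrite mulrC -fsumMl.
Qed.

Lemma conv_sum (T : Type) (s : seq T) (G : nat -> T -> A) (f : T -> A) :
  (forall t, conv (G^~ t) (f t)) ->
  conv (fun N => \sum_(t <- s) G N t) (\sum_(t <- s) f t).
Proof.
move=> cG d; elim: s => [|t s [N0 IHs]].
  by exists 0%N => N _; rewrite !big_nil subrr.
have [N1 h] := cG t d; exists (maxn N0 N1) => N le_N.
rewrite !big_cons opprD addrACA; apply: vanishD; [apply: h | apply: IHs]; lia.
Qed.

Lemma conv_prod n (G : nat -> nat -> A) (f : nat -> A) :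
  (forall r, conv (G^~ r) (f r)) ->
  conv (fun N => \prod_(r < n) G N r) (\prod_(r < n) f r).
Proof.
move=> cG; elim: n => [|n IHn].
  by rewrite big_ord0; apply: (eq_conv _ (conv_cst 1)) => N; rewrite big_ord0.
rewrite big_ord_recr /=; apply: (eq_conv _ (convM IHn (cG n))) => N.
by rewrite big_ord_recr.
Qed.

(** Tannery's theorem: since [o] bounds the exponents of all the [G N] at once, the
    same finite set of indices serves, modulo q^d, for every N. *)
Lemma conv_fsum (T : choiceType) (o : T -> nat) (G : nat -> T -> A) (f : T -> A) :
  proper_map o -> (forall N t, vanish (o t) (G N t)) ->
  (forall t, conv (G^~ t) (f t)) -> conv (fun N => fsum (G N)) (fsum f).
Proof.
move=> po vG cG d.
have vf t : vanish (o t) (f t).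
  have [N h] := cG t (o t); have := vanishB (vG N t) (h N (leqnn N)).
  by rewrite subKr.
have [s hs] := po d; have us := undup_uniq s.
have hs' t : t \notin undup s -> (d <= o t)%N by rewrite mem_undup; apply: hs.
have [N0 h] := conv_sum (undup s) cG d; exists N0 => N le_N.
apply: (eqm_trans (eqm_fsum us _)) => [t /hs' le_d|]; first exact: vanishW (vG N t).
apply: (eqm_trans (h N le_N)); apply/eqm_sym/eqm_fsum => // t /hs' le_d.
exact: vanishW (vf t).
Qed.

Lemma fsum_ord n (F : nat -> A) :
  fsum (fun k => if (k < n)%N then F k else 0) = \sum_(k < n) F k.
Proof.
rewrite (@fsum_fin _ _ (iota 0 n)) ?iota_uniq //; last first.
  by move=> t; rewrite mem_iota add0n /= => /negPf ->.
have -> : iota 0 n = index_iota 0 n by rewrite /index_iota subn0.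
rewrite big_mkord.
by apply: eq_bigr => k _; rewrite ltn_ord.
Qed.

Lemma proper_leq (T : choiceType) (o o' : T -> nat) : (forall t, o t <= o' t)%N ->
  proper_map o -> proper_map o'.
Proof.
move=> le_o po d; have [s hs] := po d; exists s => t /hs le_d.
exact: leq_trans (le_o t).
Qed.

Lemma proper_bound (T : choiceType) (o o' : T -> nat) K :
  (forall t, o t <= K * (o' t).+1)%N -> proper_map o -> proper_map o'.
Proof.
move=> le_o po d; have [s hs] := po (K * d).+1; exists s => t /hs lt_o.
have := leq_trans lt_o (le_o t); rewrite ltn_mul2l => /andP[_].
by rewrite ltnS.
Qed.

Lemma proper_nat : proper_map (id : nat -> nat).
Proof. by move=> d; exists (iota 0 d) => t; rewrite mem_iota /= add0n -leqNgt. Qed.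

Lemma proper_int : proper_map absz.
Proof.
move=> d; exists (map Posz (iota 0 d) ++ map Negz (iota 0 d)).
case=> n; rewrite mem_cat negb_or => /andP[h1 h2]; rewrite leqNgt; apply/negP=> lt_d.
  by case/negP: h1; rewrite map_f // mem_iota /= add0n.
by case/negP: h2; rewrite map_f // mem_iota /= add0n (leq_trans _ lt_d).
Qed.

Lemma proper_prod (T U : choiceType) (o : T -> nat) (o' : U -> nat) :
  proper_map o -> proper_map o' -> proper_map (fun tu : T * U => o tu.1 + o' tu.2)%N.
Proof.
move=> po po' d; have [s hs] := po d; have [s' hs'] := po' d.
exists [seq (t, u) | t <- s, u <- s'] => -[t u] h /=.
have [ht|/hs le_d] := boolP (t \in s); last exact: leq_trans (leq_addr _ _).
have [hu|/hs' le_d] := boolP (u \in s'); last exact: leq_trans (leq_addl _ _).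
by case/negP: h; apply/allpairsP; exists (t, u).
Qed.

Lemma proper_comp (T U : choiceType) (h : T -> U) (g : U -> T) (o : U -> nat) :
  cancel h g -> proper_map o -> proper_map (o \o h).
Proof.
move=> hK po d; have [s hs] := po d; exists (map g s) => t ht.
by apply: hs; apply: contra ht => ht; apply/mapP; exists (h t).
Qed.

End Order.

Arguments proper_int : clear implicits.

(** * Gaussian binomials and the finite triple product *)

(** The Gaussian binomial, by one of its two Pascal rules, so that it makes sense
    in rings where the quotient of q-factorials does not. *)
Fixpoint gauss (R : comNzRingType) (x : R) n k : R :=
  match n, k with
  | _, 0 => 1
  | 0, _.+1 => 0
  | n'.+1, k'.+1 => gauss x n' k' + x ^+ k * gauss x n' k
  end.

Arguments gauss : simpl never.

Section GaussianBinomials.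
Variable R : comNzRingType.
Implicit Types a b x : R.

Lemma qpoch0 b x : qpoch b x 0 = 1.
Proof. exact: big_ord0. Qed.

Lemma qpochS b x n : qpoch b x n.+1 = qpoch b x n * (1 - b * x ^+ n).
Proof. exact: big_ord_recr. Qed.

Lemma qpochSl b x n : qpoch b x n.+1 = (1 - b) * qpoch (b * x) x n.
Proof.
rewrite /qpoch big_ord_recl expr0 mulr1; congr (_ * _).
by apply: eq_bigr => i _; rewrite lift0 exprS mulrA.
Qed.

Lemma gauss0 x n : gauss x n 0 = 1.
Proof. by case: n. Qed.

Lemma gaussS x n k :
  gauss x n.+1 k.+1 = gauss x n k + x ^+ k.+1 * gauss x n k.+1.
Proof. by []. Qed.

Lemma gauss_small x n k : (n < k)%N -> gauss x n k = 0.
Proof.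
elim: n k => [|n IHn] [|k] // lt_nk.
by rewrite gaussS !IHn ?mulr0 ?addr0 //; lia.
Qed.

(** The other Pascal rule. *)
Lemma gaussSr x n k :
  gauss x n.+1 k.+1 = x ^+ (n - k) * gauss x n k + gauss x n k.+1.
Proof.
elim: n k => [|n IHn] k.
  by case: k => [|k]; rewrite /gauss /= ?mulr0 ?addr0 ?expr0 ?mulr1.
rewrite gaussS {1}(IHn k) (gaussS x n k); case: k => [|k].
  by rewrite !gauss0 !subn0 !exprS expr0 !mulr1; ring.
rewrite {1}(IHn k) (gaussS x n k) subSS.
have [lt_kn|le_nk] := ltnP k n.
  have -> : (n - k = (n - k.+1).+1)%N by lia.
  by rewrite !exprS; ring.
have -> : (n - k.+1 = n - k)%N by lia.
have -> : (n - k = 0)%N by lia.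
by rewrite [gauss x n k.+1]gauss_small //; ring.
Qed.

Lemma gauss_sym x n k : (k <= n)%N -> gauss x n (n - k) = gauss x n k.
Proof.
elim: n k => [|n IHn] k le_kn; first by rewrite leqn0 in le_kn; rewrite (eqP le_kn).
case: k le_kn => [|k] le_kn.
  rewrite subn0 gauss0 gaussS [gauss x n n.+1]gauss_small // mulr0 addr0.
  by rewrite -{2}[n]subn0 IHn // gauss0.
rewrite subSS; have [->|ne_kn] := eqVneq k n.
  rewrite subnn gauss0 gaussS [gauss x n n.+1]gauss_small // mulr0 addr0.
  by rewrite -{2}[n]subn0 IHn // gauss0.
have -> : (n - k = (n - k.+1).+1)%N by lia.
rewrite gaussS gaussSr IHn; last by lia.
have -> : ((n - k.+1).+1 = n - k)%N by lia.
by rewrite IHn; [rewrite addrC | lia].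
Qed.

Lemma gauss_fact x m k :
  gauss x (m + k) k * (qpoch x x k * qpoch x x m) = qpoch x x (m + k).
Proof.
elim: k m => [|k IHk] m; first by rewrite gauss0 addn0 qpoch0 !mul1r.
elim: m => [|m IHm].
  rewrite add0n gaussS [gauss x k k.+1]gauss_small // mulr0 addr0 qpoch0 mulr1.
  have := IHk 0%N; rewrite qpoch0 mulr1 add0n => e.
  by rewrite qpochS mulrA e.
have e1 := IHk m.+1; rewrite addSnnS in e1.
rewrite addSn gaussS [qpoch x x (m + k.+1).+1]qpochS.
have -> : (x * x ^+ (m + k.+1)) = x ^+ m.+1 * x ^+ k.+1.
  by rewrite -exprS -exprD; congr (_ ^+ _); lia.
rewrite mulrDl -mulrA mulrBr mulr1.
have -> : gauss x (m + k.+1) k * (qpoch x x k.+1 * qpoch x x m.+1)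
  = qpoch x x (m + k.+1) * (1 - x ^+ k.+1).
  by rewrite -e1 qpochS exprS; ring.
have -> : x ^+ k.+1 * (gauss x (m + k.+1) k.+1 * (qpoch x x k.+1 * qpoch x x m.+1))
  = x ^+ k.+1 * (qpoch x x (m + k.+1) * (1 - x ^+ m.+1)).
  by rewrite -IHm [qpoch x x m.+1]qpochS !exprS; ring.
ring.
Qed.

Lemma qbinomial a x n : qpoch a x n =
  \sum_(k < n.+1) (-1) ^+ k * x ^+ 'C(k, 2) * gauss x n k * a ^+ k.
Proof.
elim: n => [|n IHn]; first by rewrite qpoch0 big_ord1 gauss0 !expr0 !mulr1.
rewrite qpochS IHn mulrBr mulr1 big_distrl big_ord_recl [RHS]big_ord_recl.
rewrite !gauss0 -addrA; congr (_ + _).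
under [X in _ = X]eq_bigr => k _.
  rewrite lift0 gaussSr mulrDr mulrDl.
  over.
rewrite big_split addrC [X in _ = _ + X]big_ord_recr /=.
rewrite [gauss x n n.+1]gauss_small // mulr0 mul0r addr0.
congr (_ + _); rewrite -sumrN; apply: eq_bigr => k _.
have e : x ^+ 'C(k.+1, 2) * x ^+ (n - k) = x ^+ 'C(k, 2) * x ^+ n.
  rewrite -!exprD; congr (_ ^+ _); rewrite binS bin1.
  by have := ltn_ord k; lia.
rewrite !exprS; ring: e.
Qed.

(** For a b = x this is (-1)^n x^(n(n-1)/2) a^n for every integer n, with b in
    the role of x / a: negative indices then need no inverses. *)
Definition jmon a b x (n : int) : R :=
  match n with
  | Posz k => (-1) ^+ k * x ^+ 'C(k, 2) * a ^+ k
  | Negz k => (-1) ^+ k.+1 * x ^+ 'C(k.+1, 2) * b ^+ k.+1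
  end.

Lemma jmonN a b x n : a * b = x -> 
  jmon a b x (- n%:Z) = (-1) ^+ n * x ^+ 'C(n, 2) * b ^+ n.
Proof. by case: n. Qed.

(** The recurrence of the bilateral monomials, with negative powers of x cleared. *)
Lemma jmon_step a b x (N k : nat) : a * b = x ->
  x ^+ k * jmon a b x (k%:Z - N.+1%:Z) = - (b * x ^+ N) * jmon a b x (k%:Z - N%:Z).
Proof.
move=> abx; have [le_Nk|lt_kN] := leqP N k.
  rewrite -(subnK le_Nk); set d := (k - N)%N.
  have -> : (d + N)%N%:Z - N%:Z = d by lia.
  case: d => [|d]; first have -> : (0 + N)%N%:Z - N.+1%:Z = -1%:Z by lia.
    by rewrite jmonN //= add0n !expr0 !expr1; ring.
  have -> : (d.+1 + N)%N%:Z - N.+1%:Z = d by lia.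
  rewrite /= binS bin1 addSn exprS !exprD !exprS; ring: abx.
rewrite -(subnK (ltnW lt_kN)); set d := (N - k)%N.
have -> : k%:Z - (d + k).+1%:Z = - d.+1%:Z by lia.
have -> : k%:Z - (d + k)%N%:Z = - d%:Z by lia.
rewrite !jmonN // binS bin1 !exprD !exprS; ring.
Qed.

(** Induction on N: the factor 1 - b x^N turns one Pascal rule into the other by
    [jmon_step].  Holding in any commutative ring, it specializes to all the
    product expansions below and to polynomials in [jacobi_finite]. *)
Lemma finite_jtp a b x N M : a * b = x ->
  qpoch b x N * qpoch a x M =
  \sum_(k < (N + M).+1) gauss x (N + M) k * jmon a b x (k%:Z - N%:Z).
Proof.
move=> abx; elim: N => [|N IHN].
  rewrite qpoch0 mul1r add0n qbinomial; apply: eq_bigr => k _.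
  by rewrite subr0 /= mulrCA !mulrA.
rewrite qpochS mulrAC IHN mulrBr mulr1 big_distrl /= addSn.
rewrite [RHS]big_ord_recl gauss0 [RHS]addrC.
under [X in _ = X + _]eq_bigr => k _.
  rewrite lift0 gaussS mulrDl [X in jmon _ _ _ X](_ : _ = k%:Z - N%:Z); last by lia.
  over.
rewrite big_split /= -addrA; congr (_ + _).
have -> : - \sum_(i < (N + M).+1)
    gauss x (N + M) i * jmon a b x (i%:Z - N%:Z) * (b * x ^+ N) =
   \sum_(i < (N + M).+1) x ^+ i * gauss x (N + M) i * jmon a b x (i%:Z - N.+1%:Z).
  rewrite -sumrN; apply: eq_bigr => k _.
  by have e := jmon_step N k abx; ring: e.
rewrite big_ord_recl /= addrC gauss0 expr0 mulr1; congr (_ + _).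
rewrite [RHS]big_ord_recr /= gauss_small // mulr0 mul0r addr0.
apply: eq_bigr => k _; rewrite /bump /= add1n; congr (_ * jmon _ _ _ _); lia.
Qed.

(** Gauss's sum.  The two Pascal rules, applied to G and to the same sum H with
    weights x^i, combine to a two-step recurrence for G. *)
Lemma gauss_alternating x n :
  \sum_(i < n.*2.+1) (-1) ^+ i * gauss x n.*2 i = qpoch x (x ^+ 2) n.
Proof.
pose G m := \sum_(i < m.+1) (-1) ^+ i * gauss x m i.
suff rec : forall m, G m.+2 = (1 - x ^+ m.+1) * G m.
  rewrite -/(G n.*2); elim: n => [|n IHn].
    by rewrite /G big_ord1 expr0 mul1r qpoch0.
  by rewrite doubleS rec IHn qpochS mulrC -exprM -exprS mul2n.
pose H m := \sum_(i < m.+1) (-1) ^+ i * x ^+ i * gauss x m i.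
have G1 m : G m.+1 = H m - G m.
  rewrite /G big_ord_recl gauss0 expr0 mul1r.
  under eq_bigr => i _ do rewrite lift0 gaussS mulrDr.
  rewrite big_split /= addrCA addrC; congr (_ + _).
    rewrite /H [RHS]big_ord_recl gauss0 !expr0 !mul1r; congr (_ + _).
    rewrite big_ord_recr /= gauss_small // !mulr0 addr0.
    by apply: eq_bigr => i _; rewrite /bump /= add1n mulrA.
  by rewrite -sumrN; apply: eq_bigr => i _; rewrite exprS mulN1r mulNr.
have H1 m : H m.+1 = H m - x ^+ m.+1 * G m.
  rewrite {1}/H big_ord_recl gauss0 !expr0 !mul1r.
  under eq_bigr => i _ do rewrite lift0 gaussSr mulrDr.
  rewrite big_split /= addrCA addrC; congr (_ + _).
    rewrite /H [RHS]big_ord_recl gauss0 !expr0 !mul1r; congr (_ + _).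
    rewrite big_ord_recr /= gauss_small // !mulr0 addr0.
    by apply: eq_bigr => i _; rewrite /bump /= add1n.
  rewrite mulr_sumr -sumrN; apply: eq_bigr => i _.
  have -> : x ^+ m.+1 = x ^+ i.+1 * x ^+ (m - i).
    by rewrite -exprD; congr (_ ^+ _); have := ltn_ord i; lia.
  by rewrite exprS; ring.
by move=> m; rewrite G1 H1 G1; ring.
Qed.

(** At b = 1 the terms of index n and - n - 1 of the triple product cancel.  Paired
    before b is specialized, they exhibit the factor 1 - b and leave a
    geometric sum in b. *)
Lemma finite_jtp_folded a b x N : a * b = x ->
  (1 - b) * (qpoch (b * x) x N * qpoch a x N) =
  (1 - b) * \sum_(n < N.+1) (-1) ^+ n * gauss x (N.+1 + N) (N - n) *
     (x ^+ 'C(n, 2) * a ^+ n * \sum_(i < n.*2.+1) b ^+ i).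
Proof.
move=> abx; rewrite mulrA -qpochSl finite_jtp //.
rewrite -[in LHS](addnS N.+1 N) big_split_ord /= (reindex_inj rev_ord_inj) /=.
rewrite -big_split mulr_sumr; apply: eq_bigr => n _ /=.
have le_nN : (n <= N)%N by rewrite -ltnS.
rewrite subSS (_ : (N - n)%N%:Z - N.+1%:Z = - n.+1%:Z); last by lia.
rewrite (_ : (N.+1 + n)%N%:Z - N.+1%:Z = n%:Z); last by lia.
rewrite -[gauss x _ (N.+1 + n)]gauss_sym; last by lia.
rewrite (_ : (N.+1 + N - (N.+1 + n) = N - n)%N); last by lia.
rewrite jmonN //= binS bin1.
have geo : (1 - b) * \sum_(i < n.*2.+1) b ^+ i = 1 - b ^+ n.*2.+1.
  by rewrite -opprB mulNr -subrX1 opprB.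
have abn : x ^+ n = a ^+ n * b ^+ n by rewrite -exprMn abx.
rewrite exprD abn (exprS (-1)) (exprS b).
move: (\sum_(i < _) _) geo => G; rewrite exprS -addnn exprD => geo.
have geo' : G = 1 - b * (b ^+ n * b ^+ n) + b * G by rewrite -geo; ring.
by rewrite [RHS]mulrBl mul1r {1}geo'; ring.
Qed.

End GaussianBinomials.

Lemma rmorph_qpoch (R S : comNzRingType) (f : {rmorphism R -> S}) b x n :
  f (qpoch b x n) = qpoch (f b) (f x) n.
Proof.
rewrite rmorph_prod; apply: eq_bigr => i _.
by rewrite rmorphB rmorph1 rmorphM rmorphXn.
Qed.

Lemma rmorph_gauss (R S : comNzRingType) (f : {rmorphism R -> S}) x n k :
  f (gauss x n k) = gauss (f x) n k.
Proof.
elim: n k => [|n IHn] [|k]; rewrite ?gauss0 ?rmorph1 ?rmorph0 //.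
by rewrite !gaussS rmorphD rmorphM rmorphXn !IHn.
Qed.

(** [finite_jtp_folded] over the polynomials in b, where 1 - b can be cancelled, and
    then b = 1, where the geometric sum becomes 2n + 1. *)
Lemma jacobi_finite (R : comNzRingType) (x : R) N :
  qpoch x x N * qpoch x x N =
  \sum_(n < N.+1) (-1) ^+ n * gauss x (N.+1 + N) (N - n) *
     (x ^+ 'C(n.+1, 2) * n.*2.+1%:R).
Proof.
have := @finite_jtp_folded {poly R} x%:P 'X _ N erefl.
have reg : GRing.lreg (1 - 'X : {poly R}).
  rewrite -opprB; apply: GRing.lregN; apply: monic_lreg.
  by have := monicXsubC (1 : R); rewrite polyC1.
move/reg/(congr1 (horner_eval 1)).
rewrite rmorphM !rmorph_qpoch rmorph_sum /=.
have eX : horner_eval 1 ('X : {poly R}) = 1 by rewrite /horner_eval hornerX.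
have eC : horner_eval 1 (x%:P : {poly R}) = x by rewrite /horner_eval hornerC.
rewrite !rmorphM /= eX eC mulr1 mul1r => ->; apply: eq_bigr => n _.
rewrite !rmorphM rmorph_gauss rmorph_sum !rmorphXn !rmorphM rmorphN1 /= eX eC.
rewrite mulr1 binS bin1 exprD; congr (_ * (_ * _)).
transitivity (\sum_(i < n.*2.+1) (1 : R)); last by rewrite sumr_const card_ord.
by apply: eq_bigr => i _; rewrite rmorphXn /= eX expr1n.
Qed.

(** * Infinite products *)
Section InfiniteProducts.
Variable R : comUnitRingType.
Local Notation A := (fps R).
Implicit Types a b x : A.

(** (b; x)_oo.  The factors from n + 1 on are 1 modulo q^(n+1) when x has no
    constant term; all lemmas assume this. *)
Definition qinf b x : A := fun n => qpoch b x n.+1 n.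

Lemma qpoch_eqm b x N M : vanish 1 x -> (N <= M)%N ->
  vanish N (qpoch b x M - qpoch b x N).
Proof.
move=> hx le_NM; rewrite -(subnK le_NM); elim: (M - N)%N => [|m IHm].
  by rewrite subrr.
apply: eqm_trans IHm; rewrite addSn qpochS mulrBr mulr1 addrAC subrr add0r.
apply: vanishN; do 2!apply: vanishMr.
apply: (@vanishW _ (1 * (m + N))); first by lia.
exact: vanishX.
Qed.

Lemma qinf_eqm b x N : vanish 1 x -> vanish N (qpoch b x N - qinf b x).
Proof.
move=> hx i lt_iN; have /(_ i) := qpoch_eqm b hx lt_iN.
by rewrite !coef_fpsB /qinf => ->.
Qed.

Lemma conv_qpoch b x : vanish 1 x -> conv (qpoch b x) (qinf b x).
Proof.
by move=> hx d; exists d => N le_dN; apply: (vanishW le_dN); apply: qinf_eqm.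
Qed.

Lemma coef0_qpoch b x n : vanish 1 b -> qpoch b x n 0%N = 1.
Proof.
move=> hb; elim: n => [|n IHn]; first by rewrite qpoch0 coef_fps1.
by rewrite qpochS coef0_fpsM IHn coef_fpsB coef0_fpsM hb // coef_fps1 mul0r subr0 mulr1.
Qed.

Lemma unit_qpoch b x n : vanish 1 b -> qpoch b x n \is a GRing.unit.
Proof. by move=> hb; apply/unit_coef0/coef0_qpoch. Qed.

Lemma unit_qinf b x : vanish 1 b -> qinf b x \is a GRing.unit.
Proof. by move=> hb; apply/unit_coef0; rewrite /qinf coef0_qpoch. Qed.

Lemma gaussE x m k : vanish 1 x ->
  gauss x (m + k) k = qpoch x x (m + k) / (qpoch x x k * qpoch x x m).
Proof.
by move=> hx; rewrite -(gauss_fact x m k) mulrK // unitrM !unit_qpoch.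
Qed.

Lemma conv_gauss_fixed x k (u : nat -> nat) : vanish 1 x ->
  (forall d, exists N0, forall N, N0 <= N -> d <= u N)%N ->
  conv (fun N => gauss x (u N) k) (qpoch x x k)^-1.
Proof.
move=> hx tu; have tu' d : exists N0, forall N, (N0 <= N -> d <= u N - k)%N.
  by have [N0 h] := tu (d + k)%N; exists N0 => N /h; lia.
have Uk := unit_qpoch x k hx; have Ui := unit_qinf x hx.
have -> : (qpoch x x k)^-1 = qinf x x / (qpoch x x k * qinf x x).
  by rewrite invrM // mulrA divrr // mul1r.
have c : conv (fun N => qpoch x x (u N) / (qpoch x x k * qpoch x x (u N - k)%N))
     (qinf x x / (qpoch x x k * qinf x x)).
  apply: convM; first exact/(conv_comp tu)/conv_qpoch.
  apply: convV => [N||]; first by rewrite unitrM Uk unit_qpoch.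
    by rewrite unitrM Uk.
  apply: convM; first exact: conv_cst.
  exact/(conv_comp tu')/conv_qpoch.
apply: (conv_eventually c); have [N0 h] := tu k; exists N0 => N /h le_k.
by rewrite -{1}(subnK le_k) gaussE // subnK.
Qed.

Lemma conv_gauss x (u v : nat -> nat) : vanish 1 x ->
  (forall d, exists N0, forall N, N0 <= N -> d <= u N)%N ->
  (forall d, exists N0, forall N, N0 <= N -> d <= v N)%N ->
  conv (fun N => gauss x (u N + v N) (v N)) (qinf x x)^-1.
Proof.
move=> hx tu tv; have Ui := unit_qinf x hx.
have -> : (qinf x x)^-1 = qinf x x / (qinf x x * qinf x x).
  by rewrite invrM // mulrA divrr // mul1r.
apply: (@eq_conv _ (fun N => qpoch x x (u N + v N) / (qpoch x x (v N) * qpoch x x (u N)))).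
  by move=> N; rewrite gaussE.
apply: convM.
  apply: (@conv_comp _ (qpoch x x) _ (fun N => u N + v N)%N); last exact: conv_qpoch.
  by move=> d; have [N0 h] := tu d; exists N0 => N /h; lia.
apply: convV => [N||]; first by rewrite unitrM !unit_qpoch.
  by rewrite unitrM Ui.
by apply: convM; [apply: (conv_comp tv) | apply: (conv_comp tu)]; apply: conv_qpoch.
Qed.

Lemma proper_binomial2 : proper_map (fun n : int => 'C(`|n|, 2)).
Proof.
move=> d; have [s hs] := proper_int d.+1; exists s => t /hs.
by case: `|t|%N => // n; rewrite binS bin1; lia.
Qed.

Lemma proper_nat_int (o : int -> nat) : proper_map o -> proper_map (fun n : nat => o n).
Proof. exact: (@proper_comp _ _ Posz absz). Qed.

Lemma vanish_jmon a b x n : vanish 1 x -> vanish 'C(`|n|, 2) (jmon a b x n).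
Proof.
move=> hx; case: n => n; apply/vanishMl/vanishMr; rewrite -[X in vanish X]mul1n.
  exact: vanishX.
exact: vanishX.
Qed.

Lemma summable_jmon a b x : vanish 1 x -> summable (jmon a b x).
Proof. by move=> hx; apply: (proper_summable proper_binomial2) => n; apply: vanish_jmon. Qed.

(** The q-binomial theorem as the number of factors tends to infinity. *)
Lemma euler a x : vanish 1 x -> qinf a x =
  @fsum R nat (fun k => (-1) ^+ k * x ^+ 'C(k, 2) * a ^+ k / qpoch x x k).
Proof.
move=> hx; apply: (conv_unique (conv_qpoch a hx)).
have hv (c : A) k : vanish 'C(k, 2) ((-1) ^+ k * x ^+ 'C(k, 2) * a ^+ k * c).
  apply/vanishMl; exact: (@vanish_jmon a 0 x k).
apply: (@eq_conv _ (fun N => fsum (fun k => if (k < N.+1)%N then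
   (-1) ^+ k * x ^+ 'C(k, 2) * a ^+ k * gauss x N k else 0))).
  move=> N; rewrite fsum_ord qbinomial; apply: eq_bigr => k _; exact: mulrAC.
apply: (conv_fsum (proper_nat_int proper_binomial2)) => [N t|k].
  by case: ifP => // _; apply: hv.
apply: (@conv_eventually _ (fun N => (-1) ^+ k * x ^+ 'C(k, 2) * a ^+ k * gauss x N k)).
  apply: convM; first exact: conv_cst.
  by apply: (@conv_gauss_fixed x k id) => // d; exists d.
by exists k => N le_kN; rewrite ltnS le_kN.
Qed.

(** [finite_jtp] with n factors of the first kind while the number of factors of
    the second kind tends to infinity. *)
Lemma cauchy a b x n : vanish 1 x -> a * b = x ->
  qpoch b x n * qinf a x =
  @fsum R nat (fun k => jmon a b x (k%:Z - n%:Z) / qpoch x x k).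
Proof.
move=> hx abx; apply: (conv_unique (convM (conv_cst _) (conv_qpoch a hx))).
pose o (k : nat) := 'C(absz (k%:Z - n%:Z), 2).
have po : proper_map o.
  apply: (@proper_comp nat int (fun k => k%:Z - n%:Z) (fun z => absz (z + n%:Z))
    (fun z => 'C(`|z|, 2))); last exact: proper_binomial2.
  by move=> k; lia.
apply: (@eq_conv _ (fun M => fsum (fun k => if (k < (n + M).+1)%N then
   jmon a b x (k%:Z - n%:Z) * gauss x (n + M) k else 0))).
  move=> M; rewrite fsum_ord finite_jtp //; apply: eq_bigr => k _; exact: mulrC.
apply: (conv_fsum po) => [N t|k].
  by case: ifP => // _; apply/vanishMl/vanish_jmon.
apply: (@conv_eventually _ (fun M => jmon a b x (k%:Z - n%:Z) * gauss x (n + M) k)).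
  apply: convM; first exact: conv_cst.
  by apply: (@conv_gauss_fixed x k (addn n)) => // d; exists d => N; lia.
by exists k => N le_kN; rewrite ifT //; lia.
Qed.

(** [finite_jtp] as both numbers of factors tend to infinity. *)
Lemma jacobi_triple a b x : vanish 1 x -> a * b = x ->
  qinf b x * qinf a x * qinf x x = fsum (jmon a b x).
Proof.
move=> hx abx; have Ui := unit_qinf x hx.
suff e : qinf b x * qinf a x = fsum (fun n => (qinf x x)^-1 * jmon a b x n).
  rewrite e fsumMl; last exact: summable_jmon.
  by rewrite mulrAC (mulVr Ui) mul1r.
apply: (conv_unique (convM (conv_qpoch b hx) (conv_qpoch a hx))).
apply: (@eq_conv _ (fun N => fsum (fun n : int => if (`|n| <= N)%N then
   gauss x (N + N) (absz (n + N%:Z)) * jmon a b x n else 0))).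
  move=> N; rewrite finite_jtp //.
  rewrite (@fsum_fin _ _ _ [seq k%:Z - N%:Z | k <- iota 0 (N + N).+1]).
  - have -> : iota 0 (N + N).+1 = index_iota 0 (N + N).+1 by rewrite /index_iota subn0.
    rewrite big_map big_mkord; apply: eq_bigr => k _.
    rewrite ifT; last by have := ltn_ord k; lia.
    by rewrite subrK.
  - by rewrite map_inj_uniq ?iota_uniq // => i j; lia.
  move=> n hn; case: ifP => // le_nN; case/negP: hn; apply/mapP.
  by exists (absz (n + N%:Z)); rewrite ?mem_iota; lia.
apply: (conv_fsum proper_binomial2) => [N t|n].
  by case: ifP => // _; apply/vanishMr/vanish_jmon.
pose u N := absz (N%:Z - n); pose v N := absz (N%:Z + n).
apply: (@conv_eventually _ (fun N => gauss x (u N + v N) (v N) * jmon a b x n)).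
  apply: convM; last exact: conv_cst.
  by apply: conv_gauss => // d; exists (d + `|n|)%N => N; rewrite /u /v; lia.
exists `|n|%N => N le_nN; rewrite le_nN /u /v addrC; congr (gauss _ _ _ * _); lia.
Qed.

Lemma qinf_split b x n : vanish 1 x -> qinf b x = qpoch b x n * qinf (b * x ^+ n) x.
Proof.
move=> hx; apply: (conv_unique _ (convM (conv_cst _) (conv_qpoch (b * x ^+ n) hx))).
apply: (@eq_conv _ (fun N => qpoch b x (n + N))).
  move=> N; elim: N => [|N IHN]; first by rewrite addn0 qpoch0 mulr1.
  by rewrite addnS !qpochS IHN exprD -!mulrA.
apply: (@conv_comp _ (qpoch b x)); last exact: conv_qpoch.
by move=> d; exists d => N; lia.
Qed.

Lemma qinf_mulN b x : vanish 1 x -> qinf b x * qinf (- b) x = qinf (b ^+ 2) (x ^+ 2).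
Proof.
move=> hx; have hx2 : vanish 1 (x ^+ 2) by rewrite expr2; apply: vanishMl.
apply: (conv_unique _ (conv_qpoch (b ^+ 2) hx2)).
apply: (eq_conv _ (convM (conv_qpoch b hx) (conv_qpoch (- b) hx))) => N.
rewrite /qpoch -big_split; apply: eq_bigr => i _ /=.
by rewrite -exprM mulnC exprM; ring.
Qed.

Lemma qpoch_mod b x k n :
  qpoch b x (n * k) = \prod_(r < k) qpoch (b * x ^+ r) (x ^+ k) n.
Proof.
elim: n => [|n IHn].
  by rewrite qpoch0 big1 // => r _; rewrite qpoch0.
under eq_bigr => r _ do rewrite qpochS.
rewrite big_split /= -IHn mulSn addnC; move: (n * k)%N (mulnC n k) => m em.
under [X in _ = _ * X]eq_bigr => r _ do rewrite -mulrA -exprM -em -exprD.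
elim: k {IHn em} => [|k IHk]; first by rewrite addn0 big_ord0 mulr1.
by rewrite addnS qpochS IHk big_ord_recr /= mulrA [(m + k)%N]addnC.
Qed.

Lemma qinf_mod b x k : vanish 1 x -> (0 < k)%N ->
  qinf b x = \prod_(r < k) qinf (b * x ^+ r) (x ^+ k).
Proof.
move=> hx k0; have hxk : vanish 1 (x ^+ k).
  by case: k k0 => // k _; rewrite exprS; apply: vanishMl.
have c : conv (fun N => qpoch b x (N * k)) (qinf b x).
  apply: (@conv_comp _ (qpoch b x)); last exact: conv_qpoch.
  by move=> d; exists d => N /leq_trans -> //; apply: leq_pmulr.
apply: (conv_unique c); apply: (eq_conv (fun N => esym (qpoch_mod b x k N))).
apply: (@conv_prod _ k (fun N r => qpoch (b * x ^+ r) (x ^+ k) N)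
  (fun r => qinf (b * x ^+ r) (x ^+ k))) => r; exact: conv_qpoch.
Qed.

End InfiniteProducts.

(** * Dilation and extraction of arithmetic progressions *)
Lemma bin2_int (k : nat) : 2 * 'C(k, 2)%:Z = k%:Z * (k%:Z - 1).
Proof. by elim: k => // k IHk; rewrite binS bin1 PoszD mulrDr IHk; lia. Qed.

HB.lock Definition ell (R : comUnitRingType) (k : nat) : fps R :=
  qinf (fpsX R ^+ k) (fpsX R ^+ k).

Section Dilation.
Variable R : comUnitRingType.
Local Notation A := (fps R).
Local Notation q := (fpsX R).
Implicit Types f g : A.

(** f(q^k).  Writing [k.-1.+1] for k makes this a ring morphism for every k; the
    index 0 acts as 1. *)
Definition dil (k : nat) f : A := fun n => if (k.-1.+1 %| n)%N then f (n %/ k.-1.+1)%N else 0.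

Lemma sum_dvd (d n : nat) (G : nat -> R) : (0 < d)%N ->
  \sum_(i < n.+1) (if (d %| i)%N then G (i %/ d)%N else 0) = \sum_(j < (n %/ d).+1) G j.
Proof.
move=> d0; elim: n => [|n IHn]; first by rewrite div0n !big_ord1 dvdn0 div0n.
rewrite big_ord_recr /= IHn divnS //; case: (d %| n.+1)%N; last by rewrite addr0.
by rewrite add1n [RHS]big_ord_recr.
Qed.

Lemma coef_dilM k f g n :
  (dil k f * g) n = \sum_(j < (n %/ k.-1.+1).+1) f j * g (n - j * k.-1.+1)%N.
Proof.
rewrite -(@sum_dvd k.-1.+1 n (fun j => f j * g (n - j * k.-1.+1)%N)) //.
rewrite coef_fpsM; apply: eq_bigr => i _; rewrite /dil; case: ifP => [d|_].
  by rewrite divnK.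
by rewrite mul0r.
Qed.

Lemma dil_is_zmod_morphism k : zmod_morphism (dil k).
Proof.
move=> f g; apply/fpsP => n; rewrite coef_fpsB /dil; case: ifP => // _.
by rewrite subr0.
Qed.

Lemma dil_is_monoid_morphism k : monoid_morphism (dil k).
Proof.
split=> [|f g]; apply/fpsP => n.
  rewrite /dil !coef_fps1; case: ifP => [/dvdnP[m ->]|].
    by rewrite mulnK // muln_eq0 orbF.
  by case: n.
rewrite coef_dilM {1}/dil; case: ifP => [/dvdnP[m ->]|ndn].
  rewrite mulnK // coef_fpsM; apply: eq_bigr => i _.
  by rewrite -mulnBl /dil dvdn_mull // mulnK.
rewrite big1 // => j _; rewrite /dil dvdn_subl ?ndn ?mulr0 ?dvdn_mull //.
by rewrite -leq_divRL // -ltnS.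
Qed.

HB.instance Definition _ k := GRing.isZmodMorphism.Build A A (dil k)
  (dil_is_zmod_morphism k).
HB.instance Definition _ k := GRing.isMonoidMorphism.Build A A (dil k)
  (dil_is_monoid_morphism k).

Lemma dilM k f g : dil k (f * g) = dil k f * dil k g.
Proof. exact: rmorphM. Qed.

Lemma dilX k f n : dil k (f ^+ n) = dil k f ^+ n.
Proof. exact: rmorphXn. Qed.

Lemma dil_dil j k f : dil j.+1 (dil k.+1 f) = dil (j.+1 * k.+1) f.
Proof.
apply/fpsP => n; rewrite /dil.
have -> : (j.+1 * k.+1).-1.+1 = (k.+1 * j.+1)%N by rewrite mulnC.
rewrite /=; case: ifP => [/dvdnP[m ->]|ndn].
  rewrite mulnK // dvdn_pmul2r //; case: ifP => // /dvdnP[l ->].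
  by rewrite -mulnA !mulnK.
case: ifP => // kjn; case/negP: ndn.
exact: dvdn_trans (dvdn_mull _ (dvdnn _)) kjn.
Qed.

Lemma coef_qX n i : (q ^+ n) i = (i == n)%:R.
Proof. 
rewrite -[q ^+ n]mulr1 coef_qXM coef_fps1 subn_eq0.
by case: ltngtP.
Qed.

Lemma dil_qX k n : (0 < k)%N -> dil k (q ^+ n) = q ^+ (k * n).
Proof.
move=> k0; apply/fpsP => i; rewrite /dil !coef_qX prednK //.
case: ifP => [/dvdnP[m ->]|ndn].
  by rewrite mulnK // mulnC eqn_pmul2l.
by case: eqP => // e; rewrite e dvdn_mulr in ndn.
Qed.

Lemma dil_q k : (0 < k)%N -> dil k q = q ^+ k.
Proof. by move=> k0; rewrite -[in LHS](expr1 q) dil_qX // muln1. Qed.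

Lemma vanish_dil k d f : (0 < k)%N -> vanish d f -> vanish d (dil k f).
Proof.
move=> k0 vf i lt_i; rewrite /dil prednK //; case: ifP => // _; apply: vf.
exact: leq_ltn_trans (leq_div _ _) lt_i.
Qed.

Lemma dil_qinf k b x : (0 < k)%N -> vanish 1 x ->
  dil k (qinf b x) = qinf (dil k b) (dil k x).
Proof.
move=> k0 hx; apply: (conv_unique _ (conv_qpoch _ (vanish_dil k0 hx))).
move=> d; exists d => N le_dN; rewrite -rmorph_qpoch -rmorphB.
apply: (vanishW le_dN); apply: vanish_dil => //.
exact: qinf_eqm.
Qed.

Lemma dil_fsum k (T : choiceType) (F : T -> A) :
  dil k (fsum F) = fsum (fun t => dil k (F t)).
Proof.
apply/fpsP => n; rewrite /dil /fsum; case: ifP => // _.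
by rewrite fsbig1.
Qed.

Definition ext (m r : nat) f : A := fun n => f (m * n + r)%N.

Lemma ext_is_zmod_morphism m r : zmod_morphism (ext m r).
Proof. by []. Qed.

HB.instance Definition _ m r := GRing.isZmodMorphism.Build A A (ext m r)
  (ext_is_zmod_morphism m r).

(** Extraction is linear over the series in q^m; with [ext_qX0] and [ext_qX] it
    computes dissections modulo m term by term. *)
Lemma ext_dilM m r f g : (r < m)%N -> ext m r (dil m f * g) = f * ext m r g.
Proof.
case: m => // m lt_rm; apply/fpsP => n; rewrite /ext coef_dilM mulnC divnMDl //.
rewrite divn_small // addn0 coef_fpsM; apply: eq_bigr => i _; congr (_ * g _).
have h : (m.+1 * i <= m.+1 * n)%N by rewrite leq_mul2l -ltnS ltn_ord orbT.
by rewrite mulnBr [(n * _)%N]mulnC [(i * _)%N]mulnC /= addnBAC.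
Qed.

Lemma ext_qX m r n : (0 < m)%N -> ext m r (q ^+ (m * n + r)) = q ^+ n.
Proof.
case: m => // m _; apply/fpsP => i; rewrite /ext !coef_qX eqn_add2r.
by rewrite eqn_pmul2l.
Qed.

Lemma ext_qX0 m r n : (n != r %[mod m])%N -> ext m r (q ^+ n) = 0.
Proof.
move=> ne; apply/fpsP => i; rewrite /ext coef_qX; case: eqP => // e.
by case/eqP: ne; rewrite -e mulnC modnMDl.
Qed.

Lemma vanish_qXS k : (0 < k)%N -> vanish 1 (q ^+ k).
Proof. by move=> k0; apply: (vanishW k0); apply: vanish_qX. Qed.

Lemma ellE k : ell R k = qinf (q ^+ k) (q ^+ k).
Proof. by rewrite unlock. Qed.

Lemma unit_ell k : ell R k.+1 \is a GRing.unit.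
Proof. by rewrite ellE; apply/unit_qinf/vanish_qXS. Qed.

Lemma dil_ell j k : dil j.+1 (ell R k.+1) = ell R (j.+1 * k.+1).
Proof. by rewrite !ellE dil_qinf ?dil_qX //; apply: vanish_qXS. Qed.

(** The exponent [e] is given by an equation, so that each theta series can be
    described by its own quadratic polynomial. *)
Lemma jmon_qX (c : A) (m r s : nat) (n : int) (e : nat) : (r + s = m)%N ->
  2 * e%:Z = m%:Z * (n * (n - 1)) + 2 * r%:Z * n ->
  jmon (c * q ^+ r) (c * q ^+ s) (q ^+ m) n = (- c) ^+ `|n| * q ^+ e.
Proof.
move=> <- {m}.
case: n => k he /=; rewrite -exprM exprMn [(- c) ^+ _]exprNn.
  have -> : e = ((r + s) * 'C(k, 2) + r * k)%N.
    by have := bin2_int k; lia.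
  by rewrite exprD (exprM q r k); ring.
have -> : e = ((r + s) * 'C(k.+1, 2) + s * k.+1)%N.
  have := bin2_int k.+1; move: he; rewrite NegzE; lia.
by rewrite exprD (exprM q s k.+1); ring.
Qed.

End Dilation.

(** * Theta series *)
Lemma fsum_finprod (R : comUnitRingType) (I : finType) (T U : choiceType) (h : I * T -> U)
    (F : U -> fps R) : bijective h -> summable F ->
  fsum F = \sum_i fsum (fun t => F (h (i, t))).
Proof.
move=> bh sF; case: (bh) => g hK gK.
rewrite (fsum_bij F bh) fsum_pair; last exact: (summable_comp hK sF).
rewrite (@fsum_fin _ _ _ (index_enum I)) //; first exact: index_enum_uniq.
by move=> i; rewrite mem_index_enum.
Qed.

(** n (n - 1) / 2, which is a natural number also for negative n. *)
Definition tri (n : int) : nat :=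
  match n with Posz k => 'C(k, 2) | Negz k => 'C(k.+2, 2) end.

Definition texp (m r : nat) (n : int) : nat := absz (m%:Z * (tri n)%:Z + r%:Z * n).

Definition theta_term (R : comUnitRingType) (b : bool) m r (n : int) : fps R :=
  ((-1) ^+ b) ^+ `|n| * fpsX R ^+ texp m r n.

(** The sum over n in Z of (+-1)^n q^(m n(n-1)/2 + r n), with the minus sign when b
    is true.  In Ramanujan's notation this is f(q^r, q^(m-r)) or
    f(-q^r, -q^(m-r)). *)
HB.lock Definition theta (R : comUnitRingType) b m r : fps R :=
  fsum (theta_term R b m r).

Section Theta.
Variable R : comUnitRingType.
Local Notation A := (fps R).
Local Notation q := (fpsX R).
Local Notation ell := (ell R).

Lemma triE n : 2 * (tri n)%:Z = n * (n - 1).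
Proof.
by case: n => k; rewrite /tri bin2_int // NegzE; lia.
Qed.

Lemma texpE m r n : (r <= m)%N ->
  2 * (texp m r n)%:Z = m%:Z * (n * (n - 1)) + 2 * r%:Z * n.
Proof.
move=> le_rm; have e := triE n.
suff h : 0 <= m%:Z * (tri n)%:Z + r%:Z * n.
  rewrite /texp gez0_abs // mulrDr mulrCA e; lia.
suff : 0 <= 2 * (m%:Z * (tri n)%:Z + r%:Z * n) by lia.
rewrite mulrDr mulrCA e; case: n {e} => n; last by rewrite NegzE; nia.
by case: n => [|n]; nia.
Qed.

Local Notation theta_term := (theta_term R).
Local Notation theta := (theta R).

Lemma thetaE b m r : theta b m r = fsum (theta_term b m r).
Proof. by rewrite unlock. Qed.

Lemma theta_termE b m r n : (r <= m)%N -> 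
  theta_term b m r n = jmon ((-1) ^+ (~~ b) * q ^+ r) ((-1) ^+ (~~ b) * q ^+ (m - r)) (q ^+ m) n.
Proof.
move=> le_rm; rewrite (@jmon_qX _ _ m r (m - r) n (texp m r n)).
- by rewrite /theta_term; case: b => /=; rewrite ?expr0 ?expr1 ?opprK.
- by rewrite subnKC.
exact: texpE.
Qed.

Lemma summable_theta b m r : (0 < m)%N -> (r <= m)%N -> summable (theta_term b m r).
Proof.
move=> m0 le_rm d.
have [s hs] := @summable_jmon R ((-1) ^+ (~~ b) * q ^+ r)
  ((-1) ^+ (~~ b) * q ^+ (m - r)) (q ^+ m) (vanish_qXS R m0) d.
by exists s => t /hs; rewrite theta_termE.
Qed.

Lemma theta_prod b m r : (0 < m)%N -> (r <= m)%N ->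
  theta b m r = qinf ((-1) ^+ (~~ b) * q ^+ (m - r)) (q ^+ m)
    * qinf ((-1) ^+ (~~ b) * q ^+ r) (q ^+ m) * ell m.
Proof.
move=> m0 le_rm; rewrite thetaE ellE jacobi_triple; first last.
- rewrite mulrACA -!exprD subnKC // addnn -mul2n exprM sqrrN !expr1n.
  by rewrite mul1r.
- exact: vanish_qXS.
by apply: eq_fsum => n; apply: theta_termE.
Qed.

Lemma dil_theta k b m r : (0 < k)%N -> (r <= m)%N ->
  dil k (theta b m r) = theta b (k * m) (k * r).
Proof.
move=> k0 le_rm; rewrite !thetaE dil_fsum; apply: eq_fsum => n.
rewrite /theta_term rmorphM /= dil_qX // !rmorphXn rmorphN1.
congr (_ * _ ^+ _); have := texpE n le_rm.
have := @texpE (k * m) (k * r) n; rewrite leq_mul2l le_rm orbT => /(_ isT).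
set x := texp _ _ _; set y := texp _ _ _.
rewrite !PoszM => e1 e2; apply/eqP; rewrite -(eqn_pmul2l (isT : (0 < 2)%N)).
by rewrite -eqz_nat; apply/eqP; rewrite !PoszM e1 [2%:Z * _]mulrCA e2; ring.
Qed.

Lemma sign_abszD (x y : int) : (-1) ^+ `|x + y| = (-1) ^+ `|x| * (-1) ^+ `|y| :> A.
Proof.
rewrite -exprD -signr_odd -[RHS]signr_odd; congr (_ ^+ nat_of_bool _).
lia.
Qed.

Lemma sign_abszN (x : int) : (-1) ^+ `|- x| = (-1) ^+ `|x| :> A.
Proof. by rewrite abszN. Qed.

(** Both sides are sums over pairs of integers.  On the left a pair is either
    (u + v, u - v) or (- v - 1 - u, v - u), according to the parity of its sum,
    and in both cases the quadratic form separates u from v. *)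
Lemma theta_schroter :
  theta false 6 5 * theta true 6 3 = theta true 12 8 ^+ 2 + q * theta true 12 10 ^+ 2.
Proof.
pose h (x : bool * (int * int)) : int * int := let: (b, (u, v)) := x in
  if b then (- v - 1 - u, v - u) else (u + v, u - v).
pose g (y : int * int) : bool * (int * int) := let: (m, n) := y in
  if ((m + n) %% 2)%Z == 0 then (false, (((m + n) %/ 2)%Z, ((m - n) %/ 2)%Z))
  else (true, (- ((m + n + 1) %/ 2)%Z, - ((m - n + 1) %/ 2)%Z)).
have bh : bijective h.
  exists g.
    move=> [[] [u v]] /=; rewrite /g.
      by case: ifP => [|_]; [lia | congr (_, (_, _)); lia].
    by case: ifP => [_|]; [congr (_, (_, _)); lia | lia].
  move=> [m n]; rewrite /g /h; case: ifP => hp; congr (_, _); lia.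
have s65 := @summable_theta false 6 5 isT isT.
have s63 := @summable_theta true 6 3 isT isT.
have s8 := @summable_theta true 12 8 isT isT.
have s10 := @summable_theta true 12 10 isT isT.
rewrite !thetaE !expr2 !fsumM // (fsum_finprod bh); last exact: summable_prod.
rewrite big_bool [LHS]addrC -fsumMl; last exact: summable_prod.
congr (_ + _); apply: eq_fsum => -[u v] /=; rewrite /theta_term /=.
  have e1 := @texpE 6 5 (u + v) isT; have e2 := @texpE 6 3 (u - v) isT.
  have e3 := @texpE 12 8 u isT; have e4 := @texpE 12 8 v isT.
  rewrite expr0 expr1n expr1 mul1r sign_abszD sign_abszN.
  rewrite mulrCA [RHS]mulrACA -!exprD; congr (_ * _ ^+ _); lia.
have e1 := @texpE 6 5 (- v - 1 - u) isT; have e2 := @texpE 6 3 (v - u) isT.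
have e3 := @texpE 12 10 u isT; have e4 := @texpE 12 10 v isT.
rewrite expr0 expr1n expr1 mul1r sign_abszD sign_abszN [(-1) ^+ `|v| * _]mulrC.
rewrite mulrCA [X in _ = q * X]mulrACA [RHS]mulrCA -!exprD -exprS.
congr (_ * _ ^+ _); lia.
Qed.

(** The exponent is n (n + 1) / 2; it is divisible by 3 for n = 3l and n = - 3l - 1,
    which contribute equal terms, and is 1 mod 3 for n = 3l + 1. *)
Lemma theta_dissect3 :
  theta false 1 1 = 2 * theta false 9 6 + q * theta false 9 9.
Proof.
pose h (x : 'I_3 * int) : int := let: (r, l) := x in
  if val r == 0%N then 3 * l else if val r == 1%N then 3 * l + 1 else - 3 * l - 1.
pose g (n : int) : 'I_3 * int :=
  if (n %% 3)%Z == 0 then (inord 0, (n %/ 3)%Z) else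
  if (n %% 3)%Z == 1 then (inord 1, (n %/ 3)%Z) else (inord 2, (- ((n + 1) %/ 3)%Z)).
have bh : bijective h.
  exists g.
    move=> [[r lt_r] l]; rewrite /h /g /=.
    case: r lt_r => [|[|[|]]] //= lt_r.
    - rewrite ifT; last by lia. 
      by congr (_, _); [apply: ord_inj; rewrite inordK | lia].
    - rewrite ifF; last by lia.
      rewrite ifT; last by lia. 
      by congr (_, _); [apply: ord_inj; rewrite inordK | lia].
    - rewrite ifF; last by lia.
      rewrite ifF; last by lia.
      by congr (_, _); [apply: ord_inj; rewrite inordK | lia].
  move=> n; rewrite /g /h; case: ifP => h0; first by rewrite /= inordK //=; lia.
  by case: ifP => h1; rewrite /= inordK //=; lia.
have s11 := @summable_theta false 1 1 isT isT.
rewrite !thetaE (fsum_finprod bh) // !big_ord_recl big_ord0 addr0.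
have -> : q * fsum (theta_term false 9 9) = fsum (fun n => q * theta_term false 9 9 n).
  by rewrite -fsumMl //; apply: summable_theta.
rewrite [X in _ + X]addrC addrA.
congr (_ + _).
  rewrite mulr2n mulrDl mul1r; congr (_ + _); apply: eq_fsum => l /=.
    rewrite /theta_term !expr0 !expr1n !mul1r; congr (_ ^+ _).
    have := @texpE 1 1 (3 * l) isT; have := @texpE 9 6 l isT; lia.
  rewrite /theta_term !expr0 !expr1n !mul1r; congr (_ ^+ _).
  have := @texpE 1 1 (- 3 * l - 1) isT; have := @texpE 9 6 l isT; lia.
apply: eq_fsum => l /=.
rewrite /theta_term !expr0 !expr1n !mul1r -exprS; congr (_ ^+ _).
have := @texpE 1 1 (3 * l + 1) isT; have := @texpE 9 9 l isT; lia.
Qed.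

End Theta.

(** * Eta quotients *)

(** Ramanujan's psi(q), the sum of q^(n(n+1)/2) over n >= 0, in its product form. *)
HB.lock Definition psi (R : comUnitRingType) : fps R :=
  qinf (- fpsX R) (fpsX R) ^+ 2 * qinf (fpsX R) (fpsX R).

Section EtaQuotients.
Variable R : comUnitRingType.
Local Notation A := (fps R).
Local Notation q := (fpsX R).
Local Notation ell := (ell R).
Local Notation theta := (theta R).

Definition posq (r m : nat) : A := qinf (- q ^+ r) (q ^+ m).
Definition negq (r m : nat) : A := qinf (q ^+ r) (q ^+ m).

Lemma ell_negq k : ell k = negq k k.
Proof. exact: ellE. Qed.

Lemma theta_posq m r : (0 < m)%N -> (r <= m)%N ->
  theta false m r = posq (m - r) m * posq r m * ell m.
Proof. by move=> m0 le_rm; rewrite (theta_prod _ _ m0 le_rm) expr1 !mulN1r. Qed.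

Lemma theta_negq m r : (0 < m)%N -> (r <= m)%N ->
  theta true m r = negq (m - r) m * negq r m * ell m.
Proof. by move=> m0 le_rm; rewrite (theta_prod _ _ m0 le_rm) expr0 !mul1r. Qed.

Lemma posq_mod r m k : posq r m.+1 = \prod_(i < k.+1) posq (r + m.+1 * i) (m.+1 * k.+1).
Proof.
rewrite /posq (qinf_mod _ (vanish_qXS R (ltn0Sn m)) (ltn0Sn k)).
by apply: eq_bigr => i _; rewrite -!exprM mulNr -exprD.
Qed.

Lemma negq_mod r m k : negq r m.+1 = \prod_(i < k.+1) negq (r + m.+1 * i) (m.+1 * k.+1).
Proof.
rewrite /negq (qinf_mod _ (vanish_qXS R (ltn0Sn m)) (ltn0Sn k)).
by apply: eq_bigr => i _; rewrite -!exprM -exprD.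
Qed.

Lemma negq_mod2 r m : negq r m.+1 = negq r (m.+1 * 2) * negq (r + m.+1) (m.+1 * 2).
Proof. by rewrite (negq_mod r m 1) big_ord_recl big_ord1 muln0 addn0 muln1. Qed.

Lemma posq_mod3 r m : posq r m.+1 = posq r (m.+1 * 3)
  * (posq (r + m.+1) (m.+1 * 3) * posq (r + m.+1 * 2) (m.+1 * 3)).
Proof.
by rewrite (posq_mod r m 2) 2!big_ord_recl big_ord1 muln0 addn0 muln1.
Qed.

Lemma negq_mod3 r m : negq r m.+1 = negq r (m.+1 * 3)
  * (negq (r + m.+1) (m.+1 * 3) * negq (r + m.+1 * 2) (m.+1 * 3)).
Proof.
by rewrite (negq_mod r m 2) 2!big_ord_recl big_ord1 muln0 addn0 muln1.
Qed.

Lemma posq_negq r m : posq r m.+1 * negq r m.+1 = negq (2 * r) (2 * m.+1).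
Proof.
rewrite mulrC /posq /negq (qinf_mulN _ (vanish_qXS R (ltn0Sn m))).
by rewrite -!exprM ![(_ * 2)%N]mulnC.
Qed.

Lemma dil_posq k r m : dil k.+1 (posq r m.+1) = posq (k.+1 * r) (k.+1 * m.+1).
Proof.
rewrite /posq (dil_qinf _ (ltn0Sn k) (vanish_qXS R (ltn0Sn m))).
by rewrite rmorphN /= !dil_qX.
Qed.

Lemma dil_negq k r m : dil k.+1 (negq r m.+1) = negq (k.+1 * r) (k.+1 * m.+1).
Proof.
rewrite /negq (dil_qinf _ (ltn0Sn k) (vanish_qXS R (ltn0Sn m))).
by rewrite !dil_qX.
Qed.

Lemma posq11 : posq 1 1 * ell 1 = ell 2.
Proof. rewrite !ell_negq; exact: posq_negq. Qed.

Lemma posq33 : posq 3 3 * ell 3 = ell 6.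
Proof. rewrite !ell_negq; exact: posq_negq. Qed.

Lemma negq12 : negq 1 2 * ell 2 = ell 1.
Proof. by rewrite !ell_negq [RHS](negq_mod2 1 0). Qed.

Lemma negq24 : negq 2 4 * ell 4 = ell 2.
Proof. by rewrite !ell_negq [RHS](negq_mod2 2 1). Qed.

Lemma negq36 : negq 3 6 * ell 6 = ell 3.
Proof. by rewrite !ell_negq [RHS](negq_mod2 3 2). Qed.

Lemma posq12 : posq 1 2 * (ell 1 * ell 4) = ell 2 ^+ 2.
Proof.
have e : posq 1 2 * negq 1 2 = negq 2 4 := posq_negq 1 1.
rewrite -negq12 expr2 -{3}negq24 -e; ring.
Qed.

Lemma posq36 : posq 3 6 * (ell 3 * ell 12) = ell 6 ^+ 2.
Proof.
have := congr1 (dil 3) posq12.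
by rewrite [RHS]dilX !dilM dil_posq !dil_ell.
Qed.

Local Notation psi := (psi R).

Lemma psi_posq : psi = posq 1 1 ^+ 2 * ell 1.
Proof. by rewrite unlock ell_negq /negq !expr1. Qed.

Lemma psiE : psi * ell 1 = ell 2 ^+ 2.
Proof. rewrite -posq11 psi_posq; ring. Qed.

Lemma theta11 : theta false 1 1 = 2 * psi.
Proof.
rewrite (theta_posq (isT : 0 < 1)%N (isT : 1 <= 1)%N) subnn psi_posq.
have -> : posq 0 1 = 2 * posq 1 1; last by rewrite expr2; ring.
rewrite /posq (qinf_split _ 1 (vanish_qXS R (ltn0Sn 0))).
by rewrite qpochS qpoch0 !expr0 mul1r !expr1 !mulN1r opprK.
Qed.

(** The product (-q, -q^2; q^3)_oo lacks the factors of (-q; q)_oo whose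
    exponents are multiples of 3.  The other eta quotients follow the same
    pattern. *)
Lemma theta32 : theta false 3 2 * (ell 1 * ell 6) = ell 2 * ell 3 ^+ 2.
Proof.
rewrite (theta_posq (isT : 0 < 3)%N (isT : 2 <= 3)%N).
rewrite -posq33 -posq11 (posq_mod3 1 0).
rewrite -[(1 * 3)%N]/3%N -[(3 - 2)%N]/1%N -[(1 + 1)%N]/2%N -[(1 + 1 * 2)%N]/3%N; ring.
Qed.

(** [theta true 2 1] is phi(-q). *)
Lemma theta21 : theta true 2 1 * ell 2 = ell 1 ^+ 2.
Proof.
rewrite (theta_negq (isT : 0 < 2)%N (isT : 1 <= 2)%N) -negq12.
rewrite -[(2 - 1)%N]/1%N; ring.
Qed.

Lemma pentagonal : theta true 3 2 = ell 1.
Proof.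
rewrite (theta_negq (isT : 0 < 3)%N (isT : 2 <= 3)%N).
by rewrite !ell_negq [RHS](negq_mod3 1 0) mulrA.
Qed.

Lemma theta65 : theta false 6 5 * (ell 6 * ell 1 * ell 4) = ell 2 ^+ 2 * ell 3 * ell 12.
Proof.
apply: (mulIr (unit_ell R 5)).
have -> : theta false 6 5 * (ell 6 * ell 1 * ell 4) * ell 6 =
    theta false 6 5 * (ell 1 * ell 4) * ell 6 ^+ 2.
  by move: (theta _ _ _) (ell 1) (ell 4) (ell 6) => a b c d; ring.
rewrite -posq36 -posq12 (posq_mod3 1 1) (theta_posq (isT : 0 < 6)%N (isT : 5 <= 6)%N).
rewrite -[(2 * 3)%N]/6%N -[(6 - 5)%N]/1%N -[(1 + 2)%N]/3%N -[(1 + 2 * 2)%N]/5%N.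
by move: (posq 1 6) (posq 3 6) (posq 5 6) (ell 1) (ell 3) (ell 4) (ell 6) (ell 12)
  => a b c d e f g h; ring.
Qed.

Lemma theta65m : theta true 6 5 * (ell 2 * ell 3) = ell 1 * ell 6 ^+ 2.
Proof.
rewrite -negq36 -negq12 (negq_mod3 1 1) (theta_negq (isT : 0 < 6)%N (isT : 5 <= 6)%N).
rewrite -[(2 * 3)%N]/6%N -[(6 - 5)%N]/1%N -[(1 + 2)%N]/3%N -[(1 + 2 * 2)%N]/5%N; ring.
Qed.

End EtaQuotients.

(** * The dissection modulo 3 *)
Section PsiDissection.
Local Notation A := (fps int).
Local Notation q := (fpsX int).
Local Notation ell := (ell int).
Local Notation theta := (theta int).
Local Notation psi := (psi int).

Lemma mulr2_inj (f g : A) : 2 * f = 2 * g -> f = g.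
Proof.
rewrite !mulr_natl => e; apply/fpsP => n; have := congr1 (fun h : A => h n) e.
rewrite !mulr2n !coef_fpsD; lia.
Qed.

(** [theta_dissect3] halved: the bilateral sum counts each term of psi twice. *)
Lemma psi_dissect3 : psi = dil 3 (theta false 3 2) + q * dil 9 psi.
Proof.
apply: mulr2_inj; rewrite -theta11 theta_dissect3.
rewrite (@dil_theta int 3 false 3 2 isT isT).
have -> : theta false 9 9 = 2 * dil 9 psi.
  rewrite -(@dil_theta int 9 false 1 1 isT isT) theta11.
  by rewrite dilM rmorphMn rmorph1.
ring.
Qed.

Lemma schroter : theta false 6 5 * dil 3 (theta true 2 1) =
  ell 4 ^+ 2 + q * dil 2 (theta true 6 5) ^+ 2.
Proof.
rewrite (@dil_theta int 3 true 2 1 isT isT).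
rewrite (@dil_theta int 2 true 6 5 isT isT).
rewrite -[ell 4](dil_ell int 3 0) -pentagonal.
rewrite (@dil_theta int 4 true 3 2 isT isT).
exact: theta_schroter.
Qed.

End PsiDissection.

(** The algebra behind [eta_dissect2], over an abstract ring, where [l1] to [l12]
    stand for the [ell k] and the other letters for the theta series: replace f
    f3 by its two terms and write everything else in the [ell k]. *)
Lemma dissect2_algebra (R : comUnitRingType) (q O l1 l2 l3 l4 l6 l12 f f3 f6 g p : R) :
  l1 \is a GRing.unit -> l2 \is a GRing.unit -> l12 \is a GRing.unit ->
  O * (l1 * l2) = l4 ^+ 3 -> f * (l6 * l1 * l4) = l2 ^+ 2 * l3 * l12 ->
  f3 * l6 = l3 ^+ 2 -> g * (l4 * l6) = l2 * l12 ^+ 2 -> p * l2 = l4 ^+ 2 ->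
  f6 * l12 = l6 ^+ 2 -> f * f3 = l4 ^+ 2 + q * g ^+ 2 ->
  l3 ^+ 3 * O = p ^+ 3 * f6 + q * l12 ^+ 3 * p.
Proof.
move=> U1 U2 U12 hO hf hf3 hg hp hf6 hff.
have UM : l1 * l2 ^+ 3 * l12 \is a GRing.unit by rewrite !unitrM U1 U2 U12.
apply: (mulIr UM).
have -> : l3 ^+ 3 * O * (l1 * l2 ^+ 3 * l12) =
    (O * (l1 * l2)) * ((l2 ^+ 2 * l3 * l12) * l3 ^+ 2) by ring.
rewrite hO -hf -hf3.
have -> : l4 ^+ 3 * (f * (l6 * l1 * l4) * (f3 * l6)) = l4 ^+ 4 * l6 ^+ 2 * l1 * (f * f3).
  by ring.
rewrite hff.
have -> : (p ^+ 3 * f6 + q * l12 ^+ 3 * p) * (l1 * l2 ^+ 3 * l12) =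
    (p * l2) ^+ 3 * (f6 * l12) * l1 + q * l1 * (p * l2) * (l2 * l12 ^+ 2) ^+ 2 by ring.
by rewrite hp hf6 -hg; ring.
Qed.

(** The same for [theta_psi_eta], where [t], [a] and [p] stand for phi(-q), a(q) and
    psi(q^3). *)
Lemma theta_psi_algebra (R : comUnitRingType) (t a p l1 l2 l3 l6 : R) :
  l1 \is a GRing.unit -> l2 \is a GRing.unit -> l3 \is a GRing.unit ->
  l6 \is a GRing.unit ->
  t * l2 = l1 ^+ 2 -> a * (l1 * l6) = l2 * l3 ^+ 2 -> p * l3 = l6 ^+ 2 ->
  t * a ^+ 2 * p = l2 * l3 ^+ 3.
Proof.
move=> U1 U2 U3 U6 ht ha hp.
have U : l2 * (l1 * l6) ^+ 2 * l3 \is a GRing.unit by rewrite !unitrM U1 U2 U3 U6.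
apply: (mulIr U).
have -> : t * a ^+ 2 * p * (l2 * (l1 * l6) ^+ 2 * l3) =
  (t * l2) * (a * (l1 * l6)) ^+ 2 * (p * l3) by ring.
by rewrite ht ha hp; ring.
Qed.

Section DissectionModulo3.
Local Notation A := (fps int).
Local Notation q := (fpsX int).
Local Notation ell := (ell int).
Local Notation theta := (theta int).
Local Notation psi := (psi int).

(** The identity of [theta_schroter] says that [ell 3 ^+ 3] / [ell 1] is
    ell4^3 ell6^2 / (ell2^2 ell12) + q ell12^3 / ell4; multiplied by
    ell4^3 / ell2 both terms become polynomial in psi(q^2). *)
Lemma eta_dissect2 (O : A) : O * (ell 1 * ell 2) = ell 4 ^+ 3 ->
  ell 3 ^+ 3 * O = dil 2 psi ^+ 3 * dil 6 (theta true 2 1) + q * ell 12 ^+ 3 * dil 2 psi.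
Proof.
move=> hO.
have e2 : dil 3 (theta true 2 1) * ell 6 = ell 3 ^+ 2.
  by have := congr1 (dil 3) (theta21 int); rewrite [RHS]dilX dilM !dil_ell.
have e3 : dil 2 (theta true 6 5) * (ell 4 * ell 6) = ell 2 * ell 12 ^+ 2.
  by have := congr1 (dil 2) (theta65m int); rewrite !dilM !dil_ell.
have e4 : dil 2 psi * ell 2 = ell 4 ^+ 2.
  by have := congr1 (dil 2) (psiE int); rewrite [RHS]dilX dilM !dil_ell.
have e5 : dil 6 (theta true 2 1) * ell 12 = ell 6 ^+ 2.
  by have := congr1 (dil 6) (theta21 int); rewrite [RHS]dilX dilM !dil_ell.
exact: (dissect2_algebra (unit_ell int 0) (unit_ell int 1) (unit_ell int 11)
  hO (theta65 int) e2 e3 e4 e5 schroter).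
Qed.

Lemma ext_dil_qX m r (f : A) n : (r < m)%N -> (n != r %[mod m])%N ->
  ext m r (dil m f * q ^+ n) = 0.
Proof. by move=> lt_rm ne; rewrite (ext_dilM _ _ lt_rm) (ext_qX0 _ ne) mulr0. Qed.

Lemma ext_dil_qXr m r (f : A) : (r < m)%N -> ext m r (dil m f * q ^+ r) = f.
Proof.
move=> lt_rm; rewrite (ext_dilM _ _ lt_rm).
have := ext_qX int r 0 (leq_ltn_trans (leq0n r) lt_rm); rewrite muln0 add0n => ->.
by rewrite expr0 mulr1.
Qed.

Lemma theta_psi_eta :
  theta true 2 1 * theta false 3 2 ^+ 2 * dil 3 psi = ell 2 * ell 3 ^+ 3.
Proof.
have e : dil 3 psi * ell 3 = ell 6 ^+ 2.
  by have := congr1 (dil 3) (psiE int); rewrite [RHS]dilX dilM !dil_ell.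
exact: (theta_psi_algebra (unit_ell int 0) (unit_ell int 1) (unit_ell int 2) (unit_ell int 5)
  (theta21 int) (theta32 int) e).
Qed.

(** In [eta_dissect2] put psi(q^2) = a(q^6) + q^2 psi(q^18).  Of the exponents
    0, 2, 4, 6 and 1, 3 of the free powers of q, only 2 is 2 mod 3. *)
Lemma eta_dissect3 (O : A) : O * (ell 1 * ell 2) = ell 4 ^+ 3 ->
  ell 1 ^+ 3 * ext 3 2 O = 3 * ell 4 * ell 6 ^+ 3.
Proof.
move=> /eta_dissect2 /(congr1 (ext 3 2)).
have -> : ell 3 ^+ 3 = dil 3 (ell 1 ^+ 3) by rewrite dilX dil_ell.
have -> : ell 12 ^+ 3 = dil 3 (ell 4 ^+ 3) by rewrite dilX dil_ell.
rewrite (ext_dilM _ _ (isT : 2 < 3)%N) => ->.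
have -> : dil 6 (theta true 2 1) = dil 3 (dil 2 (theta true 2 1)).
  by rewrite (dil_dil 2 1).
have -> : dil 2 psi = dil 3 (dil 2 (theta false 3 2)) + q ^+ 2 * dil 3 (dil 6 psi).
  rewrite psi_dissect3 rmorphD /= dilM !dil_dil (@dil_q int 2 isT).
  by rewrite -psi_dissect3.
have e : dil 2 (theta true 2 1) * dil 2 (theta false 3 2) ^+ 2 * dil 6 psi
    = ell 4 * ell 6 ^+ 3.
  by have := congr1 (dil 2) theta_psi_eta; rewrite dilM dilM dilX dilM dilX dil_dil !dil_ell.
rewrite -[RHS]mulrA -{}e.
move: (dil 2 (theta true 2 1)) (dil 2 (theta false 3 2)) (dil 6 psi) (ell 4 ^+ 3)
  => t a b l.
have -> : (dil 3 a + q ^+ 2 * dil 3 b) ^+ 3 * dil 3 t + q * dil 3 l * (dil 3 a + q ^+ 2 * dil 3 b)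
  = dil 3 (t * a ^+ 3) * q ^+ 0 + dil 3 (3 * (t * a ^+ 2 * b)) * q ^+ 2
  + dil 3 (3 * (t * a * b ^+ 2)) * q ^+ 4 + dil 3 (t * b ^+ 3) * q ^+ 6
  + dil 3 (l * a) * q ^+ 1 + dil 3 (l * b) * q ^+ 3.
  rewrite !dilM rmorphMn rmorph1.
  by move: (dil 3 a) (dil 3 b) (dil 3 t) (dil 3 l) => x y z w; ring.
rewrite !raddfD /= ext_dil_qXr // 5?ext_dil_qX //.
by rewrite add0r !addr0 mulrA.
Qed.

End DissectionModulo3.

(** * The odd part of the mock theta function *)
Section MockTheta.
Local Notation A := (fps int).
Local Notation q := (fpsX int).
Local Notation ell := (ell int).
Local Notation theta := (theta int).
Local Notation psi := (psi int).
Local Notation posq := (posq int).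
Local Notation negq := (negq int).

Definition invpoch (i : nat) : A := (qpoch q q i)^-1.

Lemma dil_invpoch k i : dil k.+1 (invpoch i) = (qpoch (q ^+ k.+1) (q ^+ k.+1) i)^-1.
Proof.
rewrite rmorphV; last exact: unit_qpoch (vanish_q _).
by rewrite rmorph_qpoch /= dil_q.
Qed.

(** The exponent in [v_term_expand].  The first index is an integer because the sum
    over n >= 0 is to be completed to one over all n. *)
Definition vexp (x : int * (nat * nat)) : nat :=
  let: (n, (i, j)) := x in (absz (n + 1 + i%:Z)%R ^ 2 + absz (j%:Z - n)%R ^ 2)%N.

(** A bound on n + 1 + i and on j - n bounds n from one side or the other, according
    to its sign, and then also i and j, which are nonnegative. *)
Lemma proper_vexp : proper_map (fun x => (vexp x)./2).
Proof.
apply: (@proper_bound _ (fun x : int * (nat * nat) => absz x.1 + (x.2.1 + x.2.2))%N _ 4).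
  move=> [n [i j]]; rewrite /vexp /=.
  set a := absz (n + 1 + i%:Z)%R; set b := absz (j%:Z - n)%R.
  have le_sqr (x : nat) : (x <= x ^ 2)%N by case: x => // x; rewrite expnS leq_pmulr.
  have h : (a + b <= a ^ 2 + b ^ 2)%N by rewrite leq_add.
  suff : (absz n + (i + j) <= 2 * (a + b))%N.
    by move: (a ^ 2 + b ^ 2)%N h => z; have := odd_double_half z; lia.
  by rewrite /a /b; lia.
have p2 := @proper_prod nat nat id id proper_nat proper_nat.
exact: (@proper_prod int (nat * nat)%type absz _ proper_int p2).
Qed.

Arguments vexp : simpl never.

Lemma proper_vexp_nat :
  proper_map (fun x : nat * (nat * nat) => (vexp (x.1%:Z, x.2))./2).
Proof.
apply: (@proper_comp _ _ (fun x : nat * (nat * nat) => (x.1%:Z, x.2))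
   (fun y => (absz y.1, y.2)) (fun x => (vexp x)./2) _ proper_vexp).
by case.
Qed.

Lemma jmon_sqr z : jmon (- q) (- q) (q ^+ 2) z = q ^+ (absz z ^ 2) :> A.
Proof.
have := @jmon_qX int (-1) 2 1 1 z (absz z ^ 2) erefl.
rewrite expr1 mulN1r opprK expr1n mul1r; apply.
by rewrite expnS expn1 -[(absz z * absz z)%N%:Z]/(absz (absz z * absz z)%N)%:Z; lia.
Qed.

Definition vmon (x : int * (nat * nat)) : A :=
  dil 2 ((-1) ^+ x.2.1 * invpoch x.2.1 * invpoch x.2.2) * q ^+ vexp x.

(** (q^2;q^4)_oo = (q;q^2)_oo (-q;q^2)_oo clears the denominator of the term and
    leaves (q^(2n+3);q^2)_oo, expanded by [euler] with index i, and
    (-q;q^2)_n (-q;q^2)_oo, expanded by [cauchy] with index j. *)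
Lemma v_term_expand n :
  negq 2 4 * v_term n = fsum (fun ij : nat * nat => vmon (n%:Z, ij)).
Proof.
have hx : vanish 1 (q ^+ 2) := @vanish_qXS int 2 isT.
have hq : vanish 1 q := @vanish_q int.
have -> : negq 2 4 * v_term n = q ^+ (n.+1 ^ 2) *
    (qinf (q ^+ (2 * n + 3)) (q ^+ 2) * (qpoch (- q) (q ^+ 2) n * qinf (- q) (q ^+ 2))).
  have -> : negq 2 4 = posq 1 2 * negq 1 2 by rewrite (posq_negq int 1 1).
  have -> : negq 1 2 = qpoch q (q ^+ 2) n.+1 * qinf (q ^+ (2 * n + 3)) (q ^+ 2).
    rewrite /negq expr1 (qinf_split q n.+1 hx); congr (_ * qinf _ _).
    by rewrite -exprM -exprS; congr (_ ^+ _); lia.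
  rewrite /posq expr1 /v_term.
  have := mulVr (unit_qpoch (q ^+ 2) n.+1 hq).
  move: (qpoch q (q ^+ 2) n.+1) (qpoch q (q ^+ 2) n.+1)^-1 => x y e.
  transitivity ((y * x) * (q ^+ (n.+1 ^ 2) * (qinf (q ^+ (2 * n + 3)) (q ^+ 2)
    * (qpoch (- q) (q ^+ 2) n * qinf (- q) (q ^+ 2))))); last by rewrite e mul1r.
  by move: (qinf _ _) (qinf _ _) (qpoch _ _ _) (q ^+ (n.+1 ^ 2)) => a b c d; ring.
have e2 : - q * - q = q ^+ 2 by rewrite mulrNN expr2.
have sC : summable (fun k : nat => jmon (- q) (- q) (q ^+ 2) (k%:Z - n%:Z)
    / qpoch (q ^+ 2) (q ^+ 2) k).
  move=> d; have [s hs] := @summable_jmon int (- q) (- q) (q ^+ 2) hx d.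
  exists [seq absz (z + n%:Z) | z <- s] => j hj; apply/vanishMl/hs.
  apply: contra hj => hj; apply/mapP; exists (j%:Z - n%:Z) => //; lia.
have sE : summable (fun k : nat => (-1) ^+ k * q ^+ 2 ^+ 'C(k, 2)
    * q ^+ (2 * n + 3) ^+ k / qpoch (q ^+ 2) (q ^+ 2) k).
  move=> d; have [s hs] := @summable_jmon int (q ^+ (2 * n + 3)) 0 (q ^+ 2) hx d.
  exists [seq absz z | z <- s] => j hj; apply/vanishMl/(hs j%:Z).
  by apply: contra hj => hj; apply/mapP; exists j%:Z.
rewrite (cauchy n hx e2) (euler _ hx) (fsumM sE sC) -(fsumMl _ (summable_prod sE sC)).
apply: eq_fsum => -[i j]; rewrite jmon_sqr /vmon /vexp /=.
rewrite !dilM dilX rmorphN1 !dil_invpoch -exprM -exprM.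
have -> : (absz (n%:Z + 1 + i%:Z)%R ^ 2 + absz (j%:Z - n%:Z)%R ^ 2 =
   n.+1 ^ 2 + (2 * 'C(i, 2) + (2 * n + 3) * i) + absz (j%:Z - n%:Z)%R ^ 2)%N.
  congr (_ + _)%N.
  have -> : absz (n%:Z + 1 + i%:Z)%R = (n + 1 + i)%N by lia.
  by rewrite !expnS !expn0; have := bin2_int i; lia.
rewrite !exprD; move: (_^-1) (_^-1) => a b; ring.
Qed.

Lemma ext_fsum m r (T : choiceType) (F : T -> A) :
  ext m r (fsum F) = fsum (fun t => ext m r (F t)).
Proof. by []. Qed.

(** The part of [vmon] with odd exponents, q^(2e+1) being rewritten as q^e. *)
Definition vhalf (x : int * (nat * nat)) : A :=
  if odd (x.2.1 + x.2.2) then 0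
  else (-1) ^+ x.2.1 * invpoch x.2.1 * invpoch x.2.2 * q ^+ (vexp x)./2.

Lemma odd_vexp x : odd (vexp x) = ~~ odd (x.2.1 + x.2.2).
Proof.
case: x => n [i j]; rewrite /vexp /= oddD !oddX /=; lia.
Qed.

Lemma ext_vmon x : ext 2 1 (vmon x) = vhalf x.
Proof.
rewrite /vmon /vhalf; have := odd_vexp x; case: ifP => _ /= ov.
  by apply: ext_dil_qX => //; rewrite !modn2 ov.
rewrite (ext_dilM _ _ (isT : 1 < 2)%N); congr (_ * _).
have -> : vexp x = (2 * (vexp x)./2 + 1)%N by have := odd_double_half (vexp x); lia.
rewrite (ext_qX _ _ _ (isT : 0 < 2)%N); congr (_ ^+ _); lia.
Qed.

Lemma summable_vhalf : summable vhalf.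
Proof.
apply: (proper_summable proper_vexp) => x; rewrite /vhalf; case: ifP => // _.
apply/vanishMr/vanish_qX.
Qed.

Lemma ext_v_series : negq 1 2 * ext 2 1 v_series =
  fsum (fun x : nat * (nat * nat) => vhalf (x.1%:Z, x.2)).
Proof.
have -> : v_series = fsum v_term by [].
rewrite -(ext_dilM _ _ (isT : 1 < 2)%N) dil_negq -fsumMl; last first.
  move=> d; exists (iota 0 d) => k hk i lt_i; apply: v_term_small.
  move: hk; rewrite mem_iota /= add0n -leqNgt => le_dk.
  rewrite (leq_trans lt_i) // (leq_trans le_dk) // expnS expn1; nia.
rewrite (eq_fsum v_term_expand).
rewrite -(@fsum_pair _ _ _ (fun x : nat * (nat * nat) => vmon (x.1%:Z, x.2))).
  by rewrite ext_fsum; apply: eq_fsum => x; apply: ext_vmon.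
apply: (proper_summable proper_vexp_nat) => x; apply/vanishMr.
have half_le (v : nat) : (v./2 <= v)%N by rewrite -{2}[v]odd_double_half -addnn; lia.
exact: (vanishW (half_le _) (@vanish_qX int _)).
Qed.

(** The numbers n + 1 + i and j - n are exchanged; the factor (-1)^i becomes
    (-1)^j, the same since i + j is even. *)
Lemma vhalf_sym n i j : vhalf (- n - 1, (j, i)) = vhalf (n, (i, j)).
Proof.
rewrite /vhalf /= addnC; case: ifP => // /negbT; rewrite oddD negb_add => /eqP oij.
have -> : vexp (- n - 1, (j, i)) = vexp (n, (i, j)).
  rewrite /vexp addnC; congr (_ ^ 2 + _ ^ 2)%N; lia.
by rewrite -signr_odd -oij signr_odd [_ * _ * invpoch i]mulrAC.
Qed.

(** The terms with n < 0 repeat those with n >= 0. *)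
Lemma fsum_vhalf : fsum vhalf = 2 * (negq 1 2 * ext 2 1 v_series).
Proof.
pose h (x : bool * (nat * (nat * nat))) : int * (nat * nat) :=
  let: (b, (n, (i, j))) := x in if b then (- n%:Z - 1, (j, i)) else (n%:Z, (i, j)).
pose g (y : int * (nat * nat)) : bool * (nat * (nat * nat)) :=
  let: (n, (i, j)) := y in
  if n is Posz m then (false, (m, (i, j))) else (true, (absz (- n - 1), (j, i))).
have bh : bijective h.
  exists g.
    move=> [[] [n [i j]]] //=; rewrite (_ : - n%:Z - 1 = Negz n); last by lia.
    by congr (_, (_, _)); lia.
  by move=> [[] n [i j]] //=; congr (_, _); lia.
rewrite (fsum_finprod bh summable_vhalf) big_bool ext_v_series.
rewrite mulr_natl mulr2n; congr (_ + _); apply: eq_fsum => -[n [i j]] //=.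
exact: vhalf_sym.
Qed.

(** The factor of [vhalf] that is left once the sum over n is carried out; the
    exponent is M^2 + M with i + j = 2M. *)
Definition vdiag (ij : nat * nat) : A :=
  if odd (ij.1 + ij.2) then 0
  else (-1) ^+ ij.1 * invpoch ij.1 * invpoch ij.2
         * q ^+ ((ij.1 + ij.2)./2 ^ 2 + (ij.1 + ij.2)./2).

Lemma summable_vdiag : summable vdiag.
Proof.
apply: (@proper_summable _ _ (fun ij : nat * nat => (ij.1 + ij.2)./2)) => [|ij].
  apply: (@proper_bound _ (fun ij : nat * nat => ij.1 + ij.2)%N _ 2).
    by move=> ij; have := odd_double_half (ij.1 + ij.2); lia.
  exact: (@proper_prod nat nat id id proper_nat proper_nat).
rewrite /vdiag; case: ifP => // _; apply/vanishMr.
by apply: vanishW (leq_addl _ _) _; apply: vanish_qX.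
Qed.

(** With i + j = 2M and n = k + M - i, the two squares are (k + M + 1)^2 and
    (M - k)^2, whose sum is 2 (k^2 + k) + 2 (M^2 + M) + 1. *)
Lemma vhalf_diag k i j : vhalf (k + ((i + j)./2)%:Z - i%:Z, (i, j)) =
  vdiag (i, j) * theta_term int false 2 2 k.
Proof.
rewrite /vhalf /vdiag /=; case: ifP => [_|/negbT oij]; first by rewrite mul0r.
rewrite /theta_term expr0 expr1n mul1r -[RHS]mulrA -exprD; congr (_ * _ ^+ _).
have e := odd_double_half (i + j); rewrite (negbTE oij) add0n -mul2n in e.
have := @texpE 2 2 k isT; move: (texp 2 2 k) => t ht.
move: (i + j)./2 e => M e.
have -> : vexp (k + M%:Z - i%:Z, (i, j)) = (2 * (M ^ 2 + M + t) + 1)%N.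
  rewrite /vexp !expnS !expn0 !muln1.
  have -> : k + M%:Z - i%:Z + 1 + i%:Z = k + M%:Z + 1 by lia.
  have -> : j%:Z - (k + M%:Z - i%:Z) = M%:Z - k by lia.
  have sqr (z : int) : (absz z * absz z)%N%:Z = z * z.
    by rewrite PoszM !abszE -normrM ger0_norm // -expr2 sqr_ge0.
  apply/eqP; rewrite -eqz_nat !PoszD !sqr; apply/eqP; lia.
by rewrite mul2n addn1 /= uphalf_double.
Qed.

Lemma fsum_vhalf_diag : fsum vhalf = theta false 2 2 * fsum vdiag.
Proof.
pose sw (x : (nat * nat) * int) : int * (nat * nat) := (x.2, x.1).
have swK : cancel sw (fun y => (y.2, y.1)) by case.
have bsw : bijective sw by exists (fun y => (y.2, y.1)) => //; case.
rewrite (fsum_bij _ bsw) fsum_pair; last exact: (summable_comp swK summable_vhalf).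
rewrite -(fsumMl _ summable_vdiag); apply: eq_fsum => -[i j] /=.
have bs : bijective (fun k : int => k + ((i + j)./2)%:Z - i%:Z).
  by exists (fun n : int => n - ((i + j)./2)%:Z + i%:Z) => n; ring.
rewrite (fsum_bij _ bs) mulrC thetaE -(fsumMl _ (summable_theta int false _ _)) //.
by apply: eq_fsum => k; apply: vhalf_diag.
Qed.

Lemma qpoch_double n : qpoch q q n.*2 = qpoch q (q ^+ 2) n * qpoch (q ^+ 2) (q ^+ 2) n.
Proof.
rewrite -muln2 (qpoch_mod q q 2 n) big_ord_recl big_ord1 expr0 mulr1.
by rewrite expr1 expr2.
Qed.

(** [gauss_alternating] divided by (q;q)_2M = (q;q^2)_M (q^2;q^2)_M. *)
Lemma sum_vdiag M :
  \sum_(i < M.*2.+1) (-1) ^+ i * invpoch i * invpoch (M.*2 - i) =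
  (qpoch (q ^+ 2) (q ^+ 2) M)^-1.
Proof.
have hq : vanish 1 q := @vanish_q int.
have U n := unit_qpoch q n hq.
have U1 := unit_qpoch (q ^+ 2) M hq.
have U2 := unit_qpoch (q ^+ 2) M (@vanish_qXS int 2 isT).
apply: (mulrI (U M.*2)); rewrite mulr_sumr.
transitivity (qpoch q (q ^+ 2) M); last by rewrite qpoch_double mulrK.
rewrite -gauss_alternating; apply: eq_bigr => i _.
have le_i : (i <= M.*2)%N by rewrite -ltnS.
have := gaussE (M.*2 - i) i hq; rewrite (subnK le_i) => ->.
rewrite /invpoch (invrM (U _) (U _)); move: (_^-1) (_^-1) => a b; ring.
Qed.

(** Summing over i + j = 2M first leaves Euler's series for (-q^2;q^2)_oo. *)
Lemma fsum_vdiag : fsum vdiag = posq 2 2.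
Proof.
(* With j in Z, the map (M, i) -> (i, 2M - i) is injective without a bound on i. *)
pose F (x : nat * int) : A := if x.2 is Posz j then vdiag (x.1, j) else 0.
have sF : summable F.
  move=> d; have [s hs] := summable_vdiag d.
  exists [seq (x.1, Posz x.2) | x <- s] => -[i [j|j]] //= hij.
  by apply: hs; apply: contra hij => hij; apply/mapP; exists (i, j).
have -> : fsum vdiag = fsum F.
  rewrite (@fsum_inj _ _ _ (fun x : nat * nat => (x.1, Posz x.2))).
  - by apply: eq_fsum => -[].
  - by move=> [i j] [i' j'] /= [-> ->].
  by move=> [i [j|j]] // nh; case: nh; exists (i, j).
pose h (x : nat * nat) : nat * int := (x.2, x.1.*2%:Z - x.2%:Z).
pose g (y : nat * int) : nat * nat := ((absz (y.1%:Z + y.2))./2, y.1).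
have hK : cancel h g by move=> [M i]; rewrite /h /g /=; congr (_, _); lia.
rewrite (@fsum_inj _ _ _ h F (can_inj hK)); last first.
  move=> [i [j|j]] // nh; rewrite /F /vdiag /=; case: ifP => // oij.
  case: nh; exists ((i + j)./2, i); rewrite /h /=; congr (_, _).
  by have := odd_double_half (i + j); rewrite oij; lia.
rewrite (fsum_pair (summable_comp hK sF)) /posq euler; last exact: vanish_qXS.
apply: eq_fsum => M.
transitivity (fsum (fun i : nat => if (i < M.*2.+1)%N then
  q ^+ (M ^ 2 + M) * ((-1) ^+ i * invpoch i * invpoch (M.*2 - i)) else 0)).
  apply: eq_fsum => i; rewrite /h /F /=; case: ltnP => hi.
    have -> : M.*2%:Z - i%:Z = (M.*2 - i)%N by lia.
    rewrite /vdiag /= subnKC // odd_double doubleK; exact: mulrC.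
  by have [k ->] : exists k, M.*2%:Z - i%:Z = Negz k by exists (i - M.*2).-1; lia.
rewrite fsum_ord -mulr_sumr sum_vdiag; congr (_ / _).
rewrite [(- (q ^+ 2)) ^+ M]exprNn -!exprM mulrACA -expr2 sqrr_sign mul1r -exprD.
congr (_ ^+ _).
by rewrite !expnS expn0; have := bin2_int M; lia.
Qed.

Lemma v_odd_eta : ext 2 1 v_series * (ell 1 * ell 2) = ell 4 ^+ 3.
Proof.
have e : negq 1 2 * ext 2 1 v_series = dil 2 psi * posq 2 2.
  apply: mulr2_inj; rewrite -fsum_vhalf fsum_vhalf_diag fsum_vdiag.
  have -> : theta false 2 2 = 2 * dil 2 psi; last by rewrite mulrA.
  rewrite -(@dil_theta int 2 false 1 1 isT isT) theta11.
  by rewrite dilM rmorphMn rmorph1.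
have e1 : dil 2 psi * ell 2 = ell 4 ^+ 2.
  by have := congr1 (dil 2) (psiE int); rewrite [RHS]dilX dilM !dil_ell.
have e2 : posq 2 2 * ell 2 = ell 4 by rewrite !ell_negq; apply: posq_negq.
rewrite -(negq12 int).
have -> : ext 2 1 v_series * (negq 1 2 * ell 2 * ell 2) =
  negq 1 2 * ext 2 1 v_series * ell 2 ^+ 2.
  by move: (ext _ _ _) (negq _ _) (ell 2) => x y z; ring.
rewrite e; transitivity ((dil 2 psi * ell 2) * (posq 2 2 * ell 2)).
  by move: (dil 2 psi) (posq 2 2) (ell 2) => x y z; ring.
by rewrite e1 e2 -exprSr.
Qed.

End MockTheta.

(** * Generating functions *)
Section GeneratingFunctions.
Local Notation A := (fps int).
Local Notation q := (fpsX int).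
Local Notation ell := (ell int).
Local Notation posq := (posq int).

(** Jacobi's series, the limit of [jacobi_finite]. *)
Lemma jacobi_cube : ell 1 ^+ 3 =
  fsum (fun n : nat => (-1) ^+ n * n.*2.+1%:R * q ^+ 'C(n.+1, 2)).
Proof.
have hq : vanish 1 q := @vanish_q int.
pose F (n : nat) : A := (-1) ^+ n * n.*2.+1%:R * q ^+ 'C(n.+1, 2).
have e1 : ell 1 = qinf q q by rewrite ellE expr1.
have U1 : qinf q q \is a GRing.unit := unit_qinf q hq.
have le_o n : (n <= 'C(n.+1, 2))%N by rewrite binS bin1 leq_addl.
have po : proper_map (fun n => 'C(n.+1, 2)) := proper_leq le_o proper_nat.
have vF n (c : A) : vanish 'C(n.+1, 2) (c * F n).
  by do 2!apply: vanishMr; apply: vanish_qX.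
have sF : summable F.
  by apply: (proper_summable po) => n; rewrite -[F n]mul1r.
suff e : qinf q q * qinf q q = fsum (fun n => (qinf q q)^-1 * F n).
  rewrite e1 exprS expr2 e (fsumMl _ sF) mulVKr //.
apply: (conv_unique (convM (conv_qpoch q hq) (conv_qpoch q hq))).
apply: (@eq_conv _ (fun N => fsum (fun n => if (n < N.+1)%N then
   gauss q (N.+1 + N) (N - n) * F n else 0))).
  move=> N; rewrite fsum_ord jacobi_finite; apply: eq_bigr => n _; rewrite /F.
  by move: (gauss _ _ _) => g; ring.
apply: (conv_fsum po) => [N n|n]; first by case: ifP.
pose u N := (N.+1 + n)%N; pose v N := (N - n)%N.
apply: (@conv_eventually _ (fun N => gauss q (u N + v N) (v N) * F n)).
  apply: convM; last exact: conv_cst.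
  by apply: (conv_gauss hq) => d; exists (d + n)%N => N; rewrite /u /v; lia.
exists n => N le_nN; rewrite ltnS le_nN /u /v; congr (gauss _ _ _ * _); lia.
Qed.

Lemma jacobi_cube6 : ell 6 ^+ 3 =
  fsum (fun t : nat => (-1) ^+ t * t.*2.+1%:R * q ^+ (3 * t ^ 2 + 3 * t)).
Proof.
have := congr1 (dil 6) jacobi_cube; rewrite dilX dil_ell dil_fsum => ->.
apply: eq_fsum => t; rewrite !dilM [dil 6 ((-1) ^+ t)]dilX rmorphN1 rmorph_nat.
rewrite (@dil_qX int 6 _ isT).
congr (_ * _ ^+ _); rewrite binS bin1.
by rewrite !expnS expn0; have := bin2_int t; lia.
Qed.

(** One order better than [qinf_eqm]: the parts up to n suffice for the coefficient
    of q^n. *)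
Lemma qinf_eqmS (b x : A) N : vanish 1 b -> vanish 1 x ->
  vanish N.+1 (qpoch b x N - qinf b x).
Proof.
move=> hb hx; apply: (eqm_trans _ (@qinf_eqm _ b x N.+1 hx)).
rewrite qpochS mulrBr mulr1 opprB addrC subrK; apply: vanishMr.
have := @vanishX _ 1 x N hx; rewrite mul1n => hxN.
exact: (vanishM hb hxN).
Qed.

Lemma coef_posq11_sqr n : (posq 1 1 ^+ 2) n = (p2d n)%:Z.
Proof.
have hq : vanish 1 q := @vanish_q int.
pose S (J : {set 'I_n}) := (\sum_(i in J) i.+1)%N.
have eP : qpoch (- q) q n = \sum_(J : {set 'I_n}) q ^+ S J.
  rewrite /qpoch (eq_bigr (fun i : 'I_n => q ^+ i.+1 + 1)); last first.
    by move=> i _; rewrite mulNr opprK -exprS addrC.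
  rewrite bigA_distr; apply: eq_bigr => J _.
  by rewrite -big_mkcond /S -expr_sum.
have -> : (posq 1 1 ^+ 2) n = (qpoch (- q) q n * qpoch (- q) q n) n.
  apply/esym/eqP; rewrite -subr_eq0 -coef_fpsB expr2 /posq expr1.
  have e := @qinf_eqmS (- q) q n (vanishN hq) hq.
  by rewrite (eqm_mul e e).
rewrite eP big_distrlr /= pair_big /= coef_fps_sum /p2d -natz -sum1_card natr_sum.
rewrite [RHS]big_mkcond; apply: eq_bigr => -[I J] _ /=.
by rewrite -exprD coef_qX inE /= eq_sym; case: eqP.
Qed.

Lemma coef_fpsMn (f : A) m i : (f *+ m) i = f i *+ m.
Proof. by elim: m => [|m IHm]; rewrite ?mulr0n // !mulrS coef_fpsD IHm. Qed.

(** Modulo q^(n+1), (1 + x) / (1 - x) with x = q^(i+1) is the sum of c(m) x^m over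
    m <= n, where c(0) = 1 and c(m) = 2 for m > 0: a part size that occurs may be
    overlined or not.  Expanding the product over i gives the multiplicity
    functions f with weight 2^k, k being the number of part sizes that occur. *)
Lemma coef_pbar n : (posq 1 1 / ell 1) n = (pbar n)%:Z.
Proof.
have hq : vanish 1 q := @vanish_q int.
pose c (m : nat) : nat := if m == 0%N then 1%N else 2.
pose G (i : 'I_n) : A := \sum_(m < n.+1) (c m)%:R * q ^+ (m * i.+1).
pose P : A := \prod_(i < n) G i.
have eG (i : 'I_n) : vanish n.+1 ((1 - q * q ^+ i) * G i - (1 - (- q) * q ^+ i)).
  rewrite -exprS mulNr -exprS /G.
  under eq_bigr => m _ do rewrite mulnC exprM.
  have hx : vanish 1 (q ^+ i.+1) := @vanish_qXS int i.+1 isT.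
  move: (q ^+ i.+1) hx => x hx.
  have -> : (1 - x) * \sum_(m < n.+1) (c m)%:R * x ^+ m - (1 - - x) = - (2 * x ^+ n.+1).
    elim: (n) => [|k IHk]; first by rewrite big_ord1 /c /= !mulr1; ring.
    rewrite big_ord_recr mulrDr /c /= addrAC IHk !exprS; ring.
  by apply/vanishN/vanishMr; have := @vanishX _ 1 x n.+1 hx; rewrite mul1n.
have e1 : vanish n.+1 (qpoch q q n * P - qpoch (- q) q n).
  rewrite /qpoch /P -big_split /=.
  elim/big_rec2: _ => [|i x y _ e]; first by rewrite subrr.
  exact: eqm_mul.
have -> : (posq 1 1 / ell 1) n = P n.
  have U : qpoch q q n \is a GRing.unit by apply: unit_qpoch.
  have Ui : qinf q q \is a GRing.unit by apply: unit_qinf.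
  apply/esym/eqP; rewrite -subr_eq0 -coef_fpsB ellE /posq expr1; apply/eqP.
  suff : vanish n.+1 (P - qinf (- q) q / qinf q q) by apply.
  have e2 : vanish n.+1 (P - qpoch (- q) q n / qpoch q q n).
    have -> : P - qpoch (- q) q n / qpoch q q n
      = (qpoch q q n)^-1 * (qpoch q q n * P - qpoch (- q) q n).
      by rewrite mulrBr mulKr // mulrC.
    exact: vanishMr.
  apply: (eqm_trans e2); apply: eqm_mul; first exact: qinf_eqmS (vanishN hq) hq.
  by apply: eqm_inv => //; apply: qinf_eqmS.
rewrite /P bigA_distr_bigA coef_fps_sum /pbar -natz -sum1_card natr_sum.
transitivity (\sum_(f : {ffun 'I_n -> 'I_n.+1}) \sum_(J : {set 'I_n})
   ((\sum_(i < n) f i * i.+1 == n)%N && [forall i in J, 0 < f i]%N)%:R : int); last first.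
  rewrite pair_big /= [RHS]big_mkcond; apply: eq_bigr => -[f J] _.
  by rewrite inE /=; case: ifP.
apply: eq_bigr => f _.
have -> : \prod_i ((c (f i))%:R * q ^+ (f i * i.+1)) =
    (\prod_i c (f i))%:R * q ^+ (\sum_i f i * i.+1) :> A.
  by rewrite big_split /= -expr_sum natr_prod.
rewrite mulr_natl coef_fpsMn coef_qX eq_sym; case: eqP => _ /=; last first.
  by rewrite mul0rn big1.
have -> : (\prod_i c (f i) = #|powerset [set i | 0 < f i]|)%N.
  rewrite card_powerset (eq_bigr (fun i => if (0 < f i)%N then 2 else 1)%N); last first.
    by move=> i _; rewrite /c lt0n; case: eqP.
  rewrite -big_mkcond prod_nat_const; congr (_ ^ _)%N.
  by apply: eq_card => i; rewrite inE.
rewrite -sum1_card natr_sum [LHS]big_mkcond; apply: eq_bigr => J _.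
rewrite powersetE (_ : (J \subset _) = [forall i in J, 0 < f i]%N).
  by case: ifP.
by apply/idP/idP => [/fintype.subsetP h|/forall_inP h];
  [apply/forall_inP | apply/fintype.subsetP] => i /h; rewrite inE.
Qed.

(** [eta_dissect3] applied to the odd part of v: the coefficients of q^(3n+2) there
    are the P_v(2(3n+2)+1) = P_v(6n+5). *)
Lemma P_v_series :
  ell 1 * ext 3 2 (ext 2 1 v_series) =
  3 * (ell 6 ^+ 3 * (dil 2 (posq 1 1 / ell 1) * posq 1 1 ^+ 2)).
Proof.
have h1 := eta_dissect3 v_odd_eta.
have U1 := unit_ell int 0; have U2 := unit_ell int 1.
have h2 : dil 2 (posq 1 1 / ell 1) * ell 2 = posq 2 2.
  have -> : ell 2 = dil 2 (ell 1) by rewrite dil_ell.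
  by rewrite -dilM mulrVK // dil_posq.
have h3 : posq 2 2 * ell 2 = ell 4 by rewrite !ell_negq; apply: posq_negq.
have h4 := posq11 int.
apply: (mulrI U1); apply: (mulrI U1).
move: (dil 2 _) (ext _ _ _) h1 h2 => d u h1 h2.
move: (ell 1) (ell 2) (ell 4) (ell 6) (posq 1 1) (posq 2 2) h1 h2 h3 h4
  => l1 l2 l4 l6 p1 p2 h1 h2 h3 h4.
transitivity (l1 ^+ 3 * u); first by ring.
rewrite h1 -h3 -h2.
transitivity (3 * (l6 ^+ 3 * (d * (p1 * l1) ^+ 2))); last by ring.
by rewrite h4; ring.
Qed.

(** If 3t^2 + 3t > n the inner range is empty, as is the coefficient; otherwise the
    sum over c is the Cauchy product with a series in q^2. *)
Lemma coef_jacobi_convolution n :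
  (ell 6 ^+ 3 * (dil 2 (posq 1 1 / ell 1) * posq 1 1 ^+ 2)) n =
  \sum_(t \in [set: nat]) \sum_(c \in [set c : nat |
      c%:Z <= ((n%:Z - 3 * t%:Z ^+ 2 - 3 * t%:Z) %/ 2)%Z])
    (-1) ^+ t * (2 * t%:Z + 1)
    * (p2d (n - 3 * t ^ 2 - 3 * t - 2 * c)%N)%:Z * (pbar c)%:Z.
Proof.
set C : A := dil 2 _ * _.
pose F (t : nat) : A := (-1) ^+ t * t.*2.+1%:R * q ^+ (3 * t ^ 2 + 3 * t).
have sF : summable F.
  apply: (proper_summable proper_nat) => t; apply: vanishMr.
  by apply: (vanishW _ (@vanish_qX int (3 * t ^ 2 + 3 * t))); lia.
rewrite jacobi_cube6 mulrC -(fsumMl _ sF) /fsum; apply: eq_fsbigr => t _.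
have -> : C * F t = ((-1) ^+ t * t.*2.+1%:R) * (q ^+ (3 * t ^ 2 + 3 * t) * C).
  by rewrite /F [LHS]mulrC [RHS]mulrA.
have cs (f : A) i : ((-1) ^+ t * t.*2.+1%:R * f) i = (-1) ^+ t * t.*2.+1%:R * f i.
  rewrite -mulrA mulr_natl.
  by rewrite -[(-1) ^+ t]signr_odd -[in RHS]signr_odd; case: (odd t);
    rewrite ?expr0 ?expr1 ?mulN1r ?mul1r ?coef_fpsN coef_fpsMn ?mulNr mulr_natl.
rewrite cs coef_qXM; set e := (3 * t ^ 2 + 3 * t)%N.
have ee : e%:Z = 3 * t%:Z ^+ 2 + 3 * t%:Z by rewrite /e expr2 expnS expn1; lia.
case: ltnP => [lt_ne|le_en].
  rewrite mulr0 fsbig1 // => c /= hc; exfalso; move: hc ee; move: (t%:Z ^+ 2) => tt; lia.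
have en : (n - 3 * t ^ 2 - 3 * t = n - e)%N by rewrite /e; lia.
have hc (c : nat) : (c%:Z <= ((n%:Z - 3 * t%:Z ^+ 2 - 3 * t%:Z) %/ 2)%Z) =
    (c \in index_iota 0 ((n - e) %/ 2).+1).
  rewrite mem_index_iota ltnS /=; move: ee; move: (t%:Z ^+ 2) => tt; lia.
set s := index_iota _ _ in hc; have us : uniq s := iota_uniq _ _.
rewrite en (fsbigE s) //; last 2 first.
- by move=> c; rewrite /= hc.
- by move=> c; rewrite /= hc => ->.
rewrite big_seq_cond (eq_bigl (fun c => c \in s)); last first.
  by move=> c; apply/idP/idP => [/andP[]//|sc]; rewrite sc inE /= hc.
rewrite -big_seq /C coef_dilM mulr_sumr /s big_mkord; apply: eq_bigr => c _.
rewrite coef_pbar coef_posq11_sqr [(c * _)%N]mulnC.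
have -> : (t.*2.+1%:R : int) = 2 * t%:Z + 1 by rewrite natz; lia.
by rewrite -!mulrA; congr (_ * (_ * _)); apply: mulrC.
Qed.

Arguments P_v : simpl never.

(** The sum over the integers given by [pentagonal], split into m = 0, m > 0 and
    m < 0. *)
Lemma coef_pentagonal_P_v n :
  (ell 1 * ext 3 2 (ext 2 1 v_series)) n =
  P_v (6 * n%:Z + 5)
  + \sum_(m \in [set m : nat | (1 <= m)%N])
      (-1) ^+ m * (P_v (6 * n%:Z - 9 * m%:Z ^+ 2 - 3 * m%:Z + 5)
                   + P_v (6 * n%:Z - 9 * m%:Z ^+ 2 + 3 * m%:Z + 5)).
Proof.
set U := ext 3 2 _.
pose G (m : int) : int := (-1) ^+ `|m| * P_v (6 * n%:Z - 9 * m ^+ 2 - 3 * m + 5).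
have GE (m : int) : (U * theta_term int true 3 2 m) n = G m.
  have ht := @texpE 3 2 m isT; move: ht; rewrite /theta_term expr1; move: (texp 3 2 m) => e he.
  rewrite mulrCA [U * _]mulrC.
  have -> : ((-1) ^+ `|m| * (q ^+ e * U)) n = (-1) ^+ `|m| * (q ^+ e * U) n.
    by rewrite -[(-1) ^+ `|m|]signr_odd -[in RHS]signr_odd; case: (odd `|m|);
      rewrite ?expr0 ?expr1 ?mulN1r ?mul1r.
  rewrite /G; congr (_ * _); rewrite coef_qXM.
  have -> : 6 * n%:Z - 9 * m ^+ 2 - 3 * m + 5 = 6 * n%:Z - 6 * e%:Z + 5.
    by move: he; rewrite expr2; lia.
  case: ltnP => [lt_ne|le_en].
    have [k ->] : exists k, 6 * n%:Z - 6 * e%:Z + 5 = Negz k.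
      by exists (absz (6 * n%:Z - 6 * e%:Z + 5)).-1; lia.
    by [].
  have -> : 6 * n%:Z - 6 * e%:Z + 5 = (2 * (3 * (n - e) + 2) + 1)%N by lia.
  by [].
have G0 (m : int) : (n < `|m|)%N -> G m = 0.
  move=> lt_nm; rewrite /G.
  have [k ->] : exists k, 6 * n%:Z - 9 * m ^+ 2 - 3 * m + 5 = Negz k.
    exists (absz (6 * n%:Z - 9 * m ^+ 2 - 3 * m + 5)).-1.
    have : (`|m| * `|m|)%N%:Z = m ^+ 2.
      by rewrite PoszM !abszE -normrM ger0_norm -?expr2 // sqr_ge0.
    move: (m ^+ 2) => mm <-; nia.
  by rewrite mulr0.
(* G vanishes beyond n by G0, so these integers carry the whole sum. *)
pose s := iota 1 n.
have -> : (ell 1 * U) n = \sum_(m <- 0%:Z :: ([seq Posz m | m <- s] ++ [seq - Posz m | m <- s])) G m.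
  rewrite -pentagonal thetaE mulrC -(fsumMl _ (summable_theta int true _ _)) //.
  rewrite (@coef_fsum _ _ _ _ (0%:Z :: ([seq Posz m | m <- s] ++ [seq - Posz m | m <- s]))).
  - by apply: eq_bigr => m _; apply: GE.
  - rewrite /= mem_cat cat_uniq !map_inj_uniq ?iota_uniq; [|by move=> i j; lia|by move=> i j; lia].
    rewrite andbT /=; apply/andP; split.
      by apply/negP => /orP[] /mapP[m]; rewrite mem_iota; lia.
    apply/hasPn => m /mapP[k]; rewrite mem_iota => hk ->.
    by apply/negP => /mapP[l]; rewrite mem_iota; lia.
  move=> m; rewrite GE inE mem_cat !negb_or => /and3P[m0 m1 m2]; apply: G0.
  rewrite ltnNge; apply/negP => le_mn; case: m m0 m1 m2 le_mn => m m0 m1 m2 le_mn.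
    by case/negP: m1; apply: map_f; rewrite mem_iota; lia.
  case/negP: m2; apply/mapP; exists m.+1; rewrite ?mem_iota ?NegzE //; lia.
rewrite big_cons big_cat /= !big_map -big_split /=; congr (_ + _).
  rewrite /G expr0 mul1r; congr (P_v _).
  by rewrite -[0%:Z]/(0 : int) expr0n /= !mulr0 !subr0.
rewrite (fsbigE s) ?iota_uniq //; first last.
- move=> m /= m1; rewrite mem_iota => hm.
  have := G0 m%:Z; have := G0 (- m%:Z); rewrite /G abszN /= sqrrN mulrN opprK.
  move=> e1 e2; rewrite mulrDr e1 ?e2 ?addr0 //; lia.
- by move=> m /=; rewrite mem_iota => /andP[].
rewrite [RHS]big_seq_cond [RHS](eq_bigl (fun m => m \in s)); last first.
  move=> m; apply/idP/idP => [/andP[]//|sm]; rewrite sm inE /=.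
  by move: sm; rewrite mem_iota => /andP[].
rewrite -big_seq; apply: eq_bigr => m _.
by rewrite /G abszN /= sqrrN mulrN opprK mulrDr.
Qed.

End GeneratingFunctions.

Theorem theorem3p5 (n : nat) :
  P_v (6 * n%:Z + 5)
  + \sum_(m \in [set m : nat | (1 <= m)%N])
      (-1) ^+ m * (P_v (6 * n%:Z - 9 * m%:Z ^+ 2 - 3 * m%:Z + 5)
                   + P_v (6 * n%:Z - 9 * m%:Z ^+ 2 + 3 * m%:Z + 5))
  = 3 * \sum_(t \in [set: nat])
          \sum_(c \in [set c : nat |
                  c%:Z <= ((n%:Z - 3 * t%:Z ^+ 2 - 3 * t%:Z) %/ 2)%Z])
            (-1) ^+ t * (2 * t%:Z + 1)
            * (p2d (n - 3 * t ^ 2 - 3 * t - 2 * c)%N)%:Z * (pbar c)%:Z.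
Proof.
rewrite -coef_pentagonal_P_v -coef_jacobi_convolution P_v_series.
by rewrite [in LHS]mulr_natl coef_fpsMn [RHS]mulr_natl.
Qed.
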